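(* Fix positive integers $d,L$ and let $M=d+L$. Let $S_n^{(d,L)}$ be the set of permutations in $S_n$ avoiding both patterns $d\cdots1(d+1)$ and $1\cdots(L+1)$. Then, as $n\to\infty$, \[|S_n^{(d,L)}|\sim C_{d,L}\left(\frac{\sin(\pi d/M)}{\sin(\pi/M)}\right)^{2n},\qquad C_{d,L}=\frac{1}{M^{d-1}}\prod_{j=1}^{d-1}\left(4\sin^2(\pi j/M)\right)^{d-j}.\]
   Context: A permutation $\pi\in S_n$ (one-line notation) avoids $1\cdots(L+1)$ if it has no increasing subsequence of length $L+1$; it avoids $d\cdots1(d+1)$ if there are no indices $i_1<\dots<i_{d+1}$ with $\pi(i_1)>\dots>\pi(i_d)$ and $\pi(i_{d+1})>\pi(i_1)$. *)

(* Defs.v *)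
From Stdlib Require Import Reals.
From mathcomp Require Import all_boot all_fingroup.
Set Implicit Arguments. Unset Strict Implicit. Unset Printing Implicit Defensive.

Definition contains_inc (n L : nat) (s : {perm 'I_n}) : bool :=
  [exists f : {ffun 'I_L.+1 -> 'I_n},
     [forall i : 'I_L.+1, forall j : 'I_L.+1, (i < j) ==> ((f i < f j) && (s (f i) < s (f j)))]].

Definition contains_dec_then_big (n d : nat) (s : {perm 'I_n}) : bool :=
  [exists f : {ffun 'I_d.+1 -> 'I_n},
     [forall i : 'I_d.+1, forall j : 'I_d.+1, (i < j) ==> (f i < f j)] &&
     [forall i : 'I_d.+1, forall j : 'I_d.+1,
        ((i < j) && (j < d)) ==> (s (f j) < s (f i))] &&
     (s (f ord0) < s (f ord_max))].

Definition S_dL (d L n : nat) : {set {perm 'I_n}} :=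
  [set s : {perm 'I_n} | ~~ contains_dec_then_big d s && ~~ contains_inc L s].

Local Open Scope R_scope.

Definition growth (d L : nat) : R :=
  Rdiv (sin (Rdiv (Rmult PI (INR d)) (INR (d + L)))) (sin (Rdiv PI (INR (d + L)))).

Definition C_dL (d L : nat) : R :=
  Rmult (Rinv (pow (INR (d + L)) (d - 1)))
   (foldr Rmult 1
      [seq pow (Rmult 4 (pow (sin (Rdiv (Rmult PI (INR j)) (INR (d + L)))) 2)) (d - j)
      | j <- iota 1 (d - 1)]).

(* Main.v *)
(* Build a permutation by appending values on the right. By Schensted's theorem the rank at which a
   value may be appended depends only on the insertion tableau: the entries below it must form a
   tableau with fewer than [d] rows and fewer than [L] columns. Summed over all tableaux of a given
   shape [lam] inside the [d] x [L] rectangle, the number [F_n lam] of continuations by [n] values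
   depends on [lam] through two rules. If [lam] has fewer than [d] rows and [L] columns, then
   [F_(n+1) lam] is the sum of [F_n] over the shapes with one more cell, because row insertion is a
   bijection; otherwise [F_n lam] is the sum of [F_n] over the shapes with one cell less, because
   the largest entry no longer matters.

   Let [M = d + L]. The determinants [det (z_a ^ (lam_b - b))] in [M]-th roots of unity satisfy the
   same two rules: multiplying by the power sum [e = sum z_a], or by its conjugate, adds or removes
   one cell, and the terms leaving the rectangle vanish since two exponents become congruent
   modulo [M]. Orthogonality of these determinants fixes the initial values, hence
   [#|S_n| d! M^d] is the sum of [|e(z)|^(2n) |Vandermonde(z)|^2] over all [d]-tuples [z]. Among the
   tuples of distinct roots, [|e(z)|] is maximal exactly on the [M d!] tuples of consecutive roots,
   where it is [sin (pi d / M) / sin (pi / M)]. *)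

Require Import Defs.
From Stdlib Require Import Reals.
From mathcomp Require Import all_boot all_fingroup.
From mathcomp Require Import all_order all_algebra.
From mathcomp Require Import zify ring lra.
From mathcomp Require Import boolp complex Rstruct.
Set Implicit Arguments. Unset Strict Implicit. Unset Printing Implicit Defensive.
Import GRing.Theory Num.Theory Order.TTheory.

(** * Row insertion on lattice words *)

(* Length of the longest strictly increasing subsequence all of whose letters are at least [m]. *)
Fixpoint incr_len (m : nat) (s : seq nat) : nat :=
  if s is r :: s' then
    if m <= r then maxn (incr_len m s') (incr_len r.+1 s').+1 else incr_len m s'
  else 0.

(* A standard tableau is encoded by its lattice word, whose [i]-th letter is the row of the entry
   [i]. Row insertion of a new entry acts on it through Fomin's local rules: while the word is
   read, [c] is the row of the cell by which the new shape exceeds the old one, and [carry] is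
   its final value. *)
Fixpoint bump_word (c : nat) (s : seq nat) : seq nat :=
  if s is r :: s' then
    if r == c then c.+1 :: bump_word c.+1 s' else r :: bump_word c s'
  else [::].

Fixpoint carry (c : nat) (s : seq nat) : nat :=
  if s is r :: s' then carry (if r == c then c.+1 else c) s' else c.

Definition insert_word (w : seq nat) (v : nat) : seq nat :=
  take v w ++ 0 :: bump_word 0 (drop v w).

Lemma incr_len_anti (m m' : nat) (s : seq nat) : m <= m' -> incr_len m' s <= incr_len m s.
Proof.
by elim: s m m' => //= r s IH m m' le_mm'; have := IH _ _ le_mm'; case: (leqP m' r);
  case: (leqP m r); lia.
Qed.

Lemma incr_len_succ (m : nat) (s : seq nat) : incr_len m s <= (incr_len m.+1 s).+1.
Proof.
elim: s m => //= r s IH m; have := IH m.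
case: (ltngtP m r) => [lt_mr|_|->]; lia.
Qed.

(** [bump_word c] turns the first [c] into [c+1], the next [c+1] into [c+2], and so on. The
    induction needs a second inequality: sequences above the threshold [c] keep their length above
    the threshold [c+1]. *)
Lemma incr_len_bump_word_ge (c m : nat) (s : seq nat) : incr_len m s <= incr_len m (bump_word c s).
Proof.
suff: forall c m, incr_len m s <= incr_len m (bump_word c s) /\
    incr_len c s <= incr_len c.+1 (bump_word c s).
  by move=> H; case: (H c m).
elim: s {c m} => //= r s IH c m.
case: eqP => [->|ne_rc] /=; last first.
  have [H1 H2] := IH c m; have [H3 _] := IH c r.+1.
  split; first by case: (leqP m r); lia.
  by case: (ltngtP c r) => //; try lia.
have [H1 H2] := IH c.+1 m; have [H3 _] := IH c.+1 c.+1.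
have [H4 _] := IH c.+1 c.
have := incr_len_succ c s; rewrite !leqnn.
by split; [case: (ltngtP m c); case: (ltngtP m c.+1)|]; lia.
Qed.

(** Subtraction is truncated: for [m <= c+1] the second term is [incr_len c s], and beyond that each
    step of [m] costs one letter. The cases [m <= c] and [m = c+1] give the two equalities below. *)
Lemma incr_len_bump_word_le (c m : nat) (s : seq nat) :
  incr_len m (bump_word c s) <= maxn (incr_len m s) (incr_len c s - (m - c.+1)).
Proof.
elim: s c m => //= r s IH c m.
case: eqP => [->|ne_rc] /=.
  have H1 := IH c.+1 m; have H2 := IH c.+1 c.+2; have H3 := incr_len_succ c s.
  have H4 := @incr_len_anti c.+1 c.+2 s; have H5 := @incr_len_anti m c.+1 s.
  by rewrite leqnn; case: (leqP m c.+1); case: (leqP m c); lia.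
have H1 := IH c m; have H2 := IH c r.+1; have H3 := @incr_len_anti m c s.
have H4 := @incr_len_anti r.+1 c s.
by case: (leqP c r); case: (leqP m r); lia.
Qed.

Lemma incr_len_bump_word (c m : nat) (s : seq nat) : m <= c ->
  incr_len m (bump_word c s) = incr_len m s.
Proof.
move=> le_mc; have := incr_len_bump_word_ge c m s; have := incr_len_bump_word_le c m s.
by have := incr_len_anti s le_mc; lia.
Qed.

(** For [c = 0] this allows a new letter [0] to be put in front of a longest sequence of the bumped
    word. *)
Lemma incr_len_bump_word_succ (c : nat) (s : seq nat) : incr_len c.+1 (bump_word c s) =
  incr_len c s.
Proof.
apply/eqP; rewrite eqn_leq; apply/andP; split.
  by have := incr_len_bump_word_le c c.+1 s; have := @incr_len_anti c c.+1 s; lia.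
elim: s c => //= r s IH c.
case: eqP => [->|ne_rc] /=; rewrite ?leqnn.
  by have := incr_len_succ c s; have := incr_len_anti s (leqnSn c.+1); have := IH c.+1; lia.
have := IH c; have := incr_len_bump_word_ge c r.+1 s.
by case: (ltngtP c r) => //; lia.
Qed.

Lemma incr_len_ins_ge (m : nat) (u s : seq nat) :
  incr_len m (u ++ s) <= incr_len m (u ++ 0 :: bump_word 0 s).
Proof.
elim: u m => /= [|r u IH] m; last by have := IH m; have := IH r.+1; case: (leqP m r); lia.
by have := incr_len_bump_word_ge 0 m s; case: (leqP m 0); lia.
Qed.

Lemma incr_len_ins_le (m : nat) (u s : seq nat) :
  incr_len m (u ++ 0 :: bump_word 0 s) <= maxn (incr_len m (u ++ s)) ((incr_len 0 s).+1 - m).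
Proof.
elim: u m => /= [|r u IH] m; last by have := IH m; have := IH r.+1; case: (leqP m r); lia.
have := incr_len_bump_word_le 0 m s; have := incr_len_bump_word_succ 0 s;
  have := @incr_len_bump_word 0 0 s.
by case: (leqP m 0) => [|]; lia.
Qed.

Lemma incr_len_cat_r (m : nat) (u s : seq nat) : incr_len m s <= incr_len m (u ++ s).
Proof. by elim: u => //= r u IH; case: (leqP m r); lia. Qed.

(** The new [0] can only start an increasing sequence, which continues in the bumped remainder above
    the threshold [1]. This matches [has_up_cons], where a subsequence omits the new value or starts
    with it. *)
Lemma incr_len_ins (u s : seq nat) :
  incr_len 0 (u ++ 0 :: bump_word 0 s) = maxn (incr_len 0 (u ++ s)) (incr_len 0 s).+1.
Proof.
have := incr_len_ins_le 0 u s; have := incr_len_ins_ge 0 u s.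
have := incr_len_cat_r 0 u (0 :: bump_word 0 s); rewrite /= incr_len_bump_word_succ; lia.
Qed.

Lemma size_bump_word (c : nat) (s : seq nat) : size (bump_word c s) = size s.
Proof. by elim: s c => //= r s IH c; case: eqP => _ /=; rewrite IH. Qed.

Lemma size_ins (w : seq nat) (v : nat) : v <= size w -> size (insert_word w v) = (size w).+1.
Proof.
by move=> le_vw; rewrite size_cat /= size_bump_word size_takel // size_drop; lia.
Qed.

Lemma take_bump_word (c b : nat) (s : seq nat) : take b (bump_word c s) = bump_word c (take b s).
Proof.
elim: s c b => [|r s IH] c [|b] //=; first by rewrite take0.
by case: eqP => _ /=; rewrite IH.
Qed.

Lemma drop_bump_word (c a : nat) (s : seq nat) :
  drop a (bump_word c s) = bump_word (carry c (take a s)) (drop a s).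
Proof.
elim: s c a => [|r s IH] c [|a] //=; first by rewrite drop0.
by case: eqP => _ /=; rewrite IH.
Qed.

Lemma take_ins_le (w : seq nat) (v b : nat) :
  b <= v -> v <= size w -> take b (insert_word w v) = take b w.
Proof.
move=> le_bv le_vw; rewrite /insert_word take_cat size_takel //.
by case: ltnP => le'; rewrite ?take_takel //; have -> : b = v by [lia]; rewrite subnn take0 cats0.
Qed.

Lemma take_ins_gt (w : seq nat) (v b : nat) :
  v <= b -> v <= size w -> take b.+1 (insert_word w v) = insert_word (take b w) v.
Proof.
move=> le_vb le_vw; rewrite /insert_word take_cat size_takel // ltnNge ltnW ?ltnS //=.
rewrite subSn //= take_bump_word take_takel //; congr (_ ++ _ :: bump_word _ _).
by rewrite take_drop subnK.
Qed.

Lemma drop_ins_le (w : seq nat) (v a : nat) :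
  a <= v -> v <= size w -> drop a (insert_word w v) = insert_word (drop a w) (v - a).
Proof.
move=> le_av le_vw; rewrite /insert_word drop_cat size_takel // drop_drop subnK //.
case: ltnP => lt_av; last by have -> : a = v by [lia]; rewrite subnn take0 drop0.
by congr (_ ++ _); rewrite take_drop subnK.
Qed.

Lemma drop_ins_gt (w : seq nat) (v a : nat) :
  v <= a -> v <= size w ->
  drop a.+1 (insert_word w v) = bump_word (carry 0 (drop v (take a w))) (drop a w).
Proof.
move=> le_va le_vw; rewrite /insert_word drop_cat size_takel // ltnNge ltnW ?ltnS //=.
by rewrite subSn //= drop_bump_word take_drop subnK // drop_drop subnK.
Qed.

Lemma count0_bump_word_pos (c : nat) (s : seq nat) :
  count_mem 0 (bump_word c.+1 s) = count_mem 0 s.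
Proof.
by elim: s c => //= r s IH c; case: eqP => [->|_] /=; rewrite IH.
Qed.

(** Only the first [0] changes, since the carry is positive afterwards. *)
Lemma count0_bump_word (s : seq nat) : count_mem 0 (bump_word 0 s) = (count_mem 0 s).-1.
Proof.
elim: s => //= r s IH; have [_|/negPf ne] := eqVneq r 0; rewrite /= ?count0_bump_word_pos //.
by rewrite ne IH.
Qed.

Lemma count0_ins (w : seq nat) (v : nat) :
  count_mem 0 (insert_word w v) = maxn (count_mem 0 w) (count_mem 0 (take v w)).+1.
Proof.
have -> : count_mem 0 w = count_mem 0 (take v w) + count_mem 0 (drop v w).
  by rewrite -count_cat cat_take_drop.
rewrite /insert_word count_cat /= count0_bump_word; case: (count_mem 0 (drop v w)) => [|k] /=; lia.
Qed.

(* A code lists the ranks, among the values read so far, of the successive values of a permutation,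
   the last value first; [code_list] is the one-line notation read from right to left. *)
Fixpoint code_word (c : seq nat) : seq nat :=
  if c is v :: c' then insert_word (code_word c') v else [::].

Fixpoint code_list (c : seq nat) : seq nat :=
  if c is v :: c' then v :: map (bump v) (code_list c') else [::].

Fixpoint wf_code (c : seq nat) : bool :=
  if c is v :: c' then (v <= size c') && wf_code c' else true.

Lemma size_code_word (c : seq nat) : wf_code c -> size (code_word c) = size c.
Proof. by elim: c => //= v c IH /andP[le_v /IH eq_sz]; rewrite size_ins eq_sz. Qed.

(** * Schensted's theorem in windows of values *)

Definition has_up (t : seq nat) (r a b : nat) :=
  exists u, [/\ subseq u t, sorted ltn u, size u = r & all (fun x => a <= x < b) u].

Definition has_down (t : seq nat) (r b : nat) :=
  exists u, [/\ subseq u t, sorted gtn u, size u = r & all (fun x => x < b) u].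

Lemma subseq_map_inv (T1 T2 : eqType) (f : T1 -> T2) (t : seq T1) (u : seq T2) :
  subseq u (map f t) -> exists2 u', subseq u' t & u = map f u'.
Proof.
move=> /subseqP[m sz_m ->]; exists (mask m t); first exact: mask_subseq.
by rewrite map_mask.
Qed.

Lemma bump_mono (v x y : nat) : (bump v x < bump v y) = (x < y).
Proof. by rewrite /bump; lia. Qed.

Lemma sorted_map_bump (v : nat) (u : seq nat) : sorted ltn (map (bump v) u) = sorted ltn u.
Proof. by rewrite sorted_map; apply: eq_sorted => x y /=; rewrite bump_mono. Qed.

Lemma sorted_map_bump_gt (v : nat) (u : seq nat) :
  sorted gtn (map (bump v) u) = sorted gtn u.
Proof. by rewrite sorted_map; apply: eq_sorted => x y /=; rewrite bump_mono. Qed.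

Lemma subseq_cons_inv (T : eqType) (x : T) (t u : seq T) :
  subseq u (x :: t) -> subseq u t \/ exists2 u', u = x :: u' & subseq u' t.
Proof.
case: u => [_|y u] /=; first by left; rewrite sub0seq.
by case: eqP => [-> sub_u|_]; [right; exists u|left].
Qed.

Lemma has_up0 (t : seq nat) (a b : nat) : has_up t 0 a b.
Proof. by exists [::]; rewrite sub0seq. Qed.

Lemma has_up_mono (t t' : seq nat) (r r' a b a' b' : nat) :
  r' <= r -> a' <= a -> b <= b' -> subseq t t' -> has_up t r a b -> has_up t' r' a' b'.
Proof.
move=> le_r le_a le_b sub_t [u [sub_u sort_u sz_u win_u]].
exists (take r' u); split; first exact: subseq_trans (take_subseq _ _) (subseq_trans sub_u _).
- exact: take_sorted.
- by rewrite size_takel // sz_u.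
- by apply/allP => x /mem_take /(allP win_u); lia.
Qed.

Lemma has_up_cons (t : seq nat) (v r a b : nat) : r > 0 ->
  has_up (v :: map (bump v) t) r a b <->
  (has_up (map (bump v) t) r a b \/
    (a <= v < b /\ has_up (map (bump v) t) r.-1 v.+1 b)).
Proof.
move=> r_gt0; split.
  move=> [u [/subseq_cons_inv[sub_u|[u' -> sub_u]] sort_u sz_u win_u]].
    by left; exists u.
  right; move: sort_u win_u sz_u => /=; rewrite path_sortedE; last exact: ltn_trans.
  move=> /andP[lt_u sort_u] /andP[win_v win_u] sz_u; split => //.
  exists u'; split=> //; first by rewrite -sz_u.
  by apply/allP => x xu; have := allP lt_u x xu; have := allP win_u x xu; lia.
move=> [|[win_v [u [sub_u sort_u sz_u win_u]]]].
  by apply: has_up_mono => //; apply: subseq_cons.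
exists (v :: u); split => /=; first by rewrite eqxx.
- rewrite path_sortedE; last exact: ltn_trans.
  by rewrite sort_u andbT; apply/allP => x /(allP win_u); lia.
- by rewrite sz_u prednK.
- by rewrite win_v; apply/allP => x /(allP win_u); lia.
Qed.

Lemma has_up_bump (t : seq nat) (v r a b a' b' : nat) :
  (forall x, (a <= bump v x < b) = (a' <= x < b')) ->
  has_up (map (bump v) t) r a b <-> has_up t r a' b'.
Proof.
move=> win; split.
  move=> [u [/subseq_map_inv[u' sub_u ->] sort_u sz_u win_u]]; exists u'.
  rewrite size_map in sz_u; rewrite sorted_map_bump in sort_u; split => //.
  by move: win_u; rewrite all_map; congr is_true; apply: eq_all => x /=; apply: win.
move=> [u [sub_u sort_u sz_u win_u]]; exists (map (bump v) u); split.
- exact: map_subseq.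
- by rewrite sorted_map_bump.
- by rewrite size_map.
- by move: win_u; rewrite all_map; congr is_true; apply: eq_all => x /=; rewrite win.
Qed.

Lemma has_down_cons (t : seq nat) (v r b : nat) : r > 0 ->
  has_down (v :: map (bump v) t) r b <->
  (has_down (map (bump v) t) r b \/
    (v < b /\ has_down (map (bump v) t) r.-1 v)).
Proof.
have gtn_trans : transitive gtn by move=> x y z /= lt1 lt2; apply: ltn_trans lt1.
move=> r_gt0; split.
  move=> [u [/subseq_cons_inv[sub_u|[u' -> sub_u]] sort_u sz_u win_u]].
    by left; exists u.
  right; move: sort_u win_u sz_u => /=; rewrite path_sortedE //.
  move=> /andP[lt_u sort_u] /andP[win_v win_u] sz_u; split => //.
  by exists u'; split=> //; rewrite -sz_u.
move=> [[u [sub_u sort_u sz_u win_u]]|[win_v [u [sub_u sort_u sz_u win_u]]]].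
  by exists u; split => //; apply: subseq_trans sub_u (subseq_cons _ _).
exists (v :: u); split => /=; first by rewrite eqxx.
- by rewrite path_sortedE // sort_u andbT; apply/allP => x /(allP win_u).
- by rewrite sz_u prednK.
- by rewrite win_v; apply/allP => x /(allP win_u); lia.
Qed.

Lemma has_down_bump (t : seq nat) (v r b b' : nat) :
  (forall x, (bump v x < b) = (x < b')) ->
  has_down (map (bump v) t) r b <-> has_down t r b'.
Proof.
move=> win; split.
  move=> [u [/subseq_map_inv[u' sub_u ->] sort_u sz_u win_u]]; exists u'.
  rewrite size_map in sz_u; rewrite sorted_map_bump_gt in sort_u; split => //.
  by move: win_u; rewrite all_map; congr is_true; apply: eq_all => x /=; apply: win.
move=> [u [sub_u sort_u sz_u win_u]]; exists (map (bump v) u); split.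
- exact: map_subseq.
- by rewrite sorted_map_bump_gt.
- by rewrite size_map.
- by move: win_u; rewrite all_map; congr is_true; apply: eq_all => x /=; rewrite win.
Qed.

(* Schensted's theorem for decreasing subsequences, in every window of values;
   the window is needed because inserting a value [v] extends the sequences
   lying above [v]. *)
Lemma has_up_code_list (c : seq nat) (r a b : nat) :
  wf_code c -> a <= b <= size c ->
  has_up (code_list c) r a b <-> r <= incr_len 0 (drop a (take b (code_word c))).
Proof.
elim: c r a b => [|v c IH] r a b /=.
  case: r => [|r] _ _; first by split => // _; apply: has_up0.
  by split => // [[u []]]; rewrite subseq0 => /eqP ->.
case: r => [|r] /andP[le_v wf_c] /andP[le_ab le_b]; first by split => // _; apply: has_up0.
have sz := size_code_word wf_c.
rewrite has_up_cons // (_ : r.+1.-1 = r) //.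
(* The window lies below [v] (nothing changes), contains [v] ([incr_len_ins]), or lies above it (a
   mere bump). Bounds above [v] drop by one, since [bump v] has shifted the values there. *)
case: (leqP b v) => [le_bv|lt_vb].
  rewrite take_ins_le ?sz // (@has_up_bump _ _ _ _ _ a b); last by move=> x; rewrite /bump; lia.
  by rewrite IH //; [split; [case=> //; lia|by left]|lia].
case: b le_ab le_b lt_vb => // b le_ab le_b lt_vb.
have le_vt : v <= size (take b (code_word c)) by rewrite size_takel ?sz; lia.
rewrite take_ins_gt ?sz //.
case: (leqP a v) => [le_av|lt_va].
  rewrite drop_ins_le // /insert_word incr_len_ins cat_take_drop drop_drop subnK //.
  rewrite (@has_up_bump _ _ _ _ _ a b); last by move=> x; rewrite /bump; lia.
  rewrite (@has_up_bump _ _ _ _ _ v b); last by move=> x; rewrite /bump; lia.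
  rewrite !IH //; try lia.
case: a le_ab lt_va => // a le_ab lt_va.
rewrite drop_ins_gt // incr_len_bump_word // (@has_up_bump _ _ _ _ _ a b); last by move=> x;
  rewrite /bump; lia.
by rewrite IH //; [split; [case=> //; lia|by left]|lia].
Qed.

(** Schensted's theorem for the increasing subsequences of the permutation. An upper bound on the
    values suffices: what follows [v] in a decreasing list lies below [v], where insertion leaves
    the word unchanged. *)
Lemma has_down_code_list (c : seq nat) (r b : nat) :
  wf_code c -> b <= size c ->
  has_down (code_list c) r b <-> r <= count_mem 0 (take b (code_word c)).
Proof.
have down0 t b' : has_down t 0 b' by exists [::]; rewrite sub0seq.
elim: c r b => [|v c IH] r b /=.
  case: r => [|r] _ _; first by split => // _; apply: down0.
  by split => // [[u []]]; rewrite subseq0 => /eqP ->.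
case: r => [|r] /andP[le_v wf_c] le_b; first by split => // _; apply: down0.
have sz := size_code_word wf_c.
rewrite has_down_cons // (_ : r.+1.-1 = r) //.
case: (leqP b v) => [le_bv|lt_vb].
  rewrite take_ins_le ?sz // (@has_down_bump _ _ _ _ b); last by move=> x; rewrite /bump; lia.
  by rewrite IH //; [split; [case=> //; lia|by left]|lia].
case: b le_b lt_vb => // b le_b lt_vb.
rewrite take_ins_gt ?sz // count0_ins take_takel //.
rewrite (@has_down_bump _ _ _ _ b); last by move=> x; rewrite /bump; lia.
rewrite (@has_down_bump _ _ _ _ v); last by move=> x; rewrite /bump; lia.
rewrite !IH //.
by rewrite leq_max ltnS; split => [[->|[_ ->]]|/orP[|]]; rewrite ?orbT //; [left|right;
  split => //; lia].
Qed.

(** * Pattern avoidance through codes *)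

Definition bad_inc (L : nat) (t : seq nat) :=
  exists u, [/\ subseq u t, sorted gtn u & size u = L.+1].

Definition bad_dec (d : nat) (t : seq nat) :=
  exists x u, [/\ subseq (x :: u) t, sorted ltn u, size u = d & all (ltn^~ x) u].

(** The list is read from right to left, so a new occurrence has the appended value [v] as its last
    and largest entry, and its other entries lie below [v]. The same holds for the other pattern. *)
Lemma bad_inc_cons (L v : nat) (t : seq nat) :
  bad_inc L (v :: map (bump v) t) <-> bad_inc L t \/ has_down t L v.
Proof.
have gtn_trans : transitive gtn by move=> x y z /= lt1 lt2; apply: ltn_trans lt1.
rewrite -(@has_down_bump t v L v v); last by move=> x; rewrite /bump; lia.
split.
  move=> [u [/subseq_cons_inv[/subseq_map_inv[u' sub_u ->]|[u' -> sub_u]] sort_u sz_u]].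
    by left; exists u'; rewrite sorted_map_bump_gt in sort_u; rewrite size_map in sz_u.
  right; exists u'; move: sort_u; rewrite /= path_sortedE // => /andP[lt_u sort_u].
  by case: sz_u.
move=> [[u [sub_u sort_u sz_u]]|[u [sub_u sort_u sz_u lt_u]]].
  exists (map (bump v) u); split; last by rewrite size_map.
    by apply: subseq_trans (subseq_cons _ _); apply: map_subseq.
  by rewrite sorted_map_bump_gt.
exists (v :: u); split; rewrite /= ?eqxx ?sz_u //.
by rewrite path_sortedE // lt_u.
Qed.

Lemma bad_dec_cons (d v : nat) (t : seq nat) :
  bad_dec d (v :: map (bump v) t) <-> bad_dec d t \/ has_up t d 0 v.
Proof.
rewrite -(@has_up_bump t v d 0 v 0 v); last by move=> x; rewrite /bump; lia.
split.
  move=> [x [u [/subseq_cons_inv[/subseq_map_inv[[|y u'] // sub_u [-> ->]]|]]]].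
    rewrite sorted_map_bump size_map all_map => sort_u sz_u lt_u; left; exists y, u'.
    by split=> //; apply: sub_all lt_u => z /=; rewrite bump_mono.
  by move=> [u' [<- <-] sub_u] sort_u sz_u lt_u; right; exists u.
move=> [[x [u [sub_u sort_u sz_u lt_u]]]|[u [sub_u sort_u sz_u lt_u]]].
  exists (bump v x), (map (bump v) u); split.
  - by apply: subseq_trans (subseq_cons _ _); apply: (map_subseq _ sub_u).
  - by rewrite sorted_map_bump.
  - by rewrite size_map.
  - by rewrite all_map; apply: sub_all lt_u => z /=; rewrite bump_mono.
by exists v, u; split; rewrite //= eqxx.
Qed.

(** An appended value completes a forbidden pattern exactly when the smaller values contain a
    decreasing subsequence of length [d] or an increasing one of length [L]. On the word of their
    tableau, the two lengths are the number of rows and the size of the first row. *)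
Definition has_room (d L : nat) (w : seq nat) : bool :=
  (incr_len 0 w < d) && (count_mem 0 w < L).

Fixpoint good (d L : nat) (c : seq nat) : bool :=
  if c is v :: c' then has_room d L (take v (code_word c')) && good d L c' else true.

Lemma good_code_list (d L : nat) (c : seq nat) : wf_code c ->
  good d L c <-> ~ bad_inc L (code_list c) /\ ~ bad_dec d (code_list c).
Proof.
elim: c => [_|v c IH] /=.
  by split=> // _; split; [move=> [[|x u] []]|move=> [x [u []]]].
move=> /andP[le_v wf_c]; rewrite bad_inc_cons bad_dec_cons.
rewrite has_up_code_list // has_down_code_list // drop0 /has_room.
move: (IH wf_c); rewrite !ltnNge; case: (good d L c) => IH'.
  have [H1 H2] := IH'.1 isT; rewrite andbT.
  split; first by move=> /andP[/negP ? /negP ?]; split; case.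
  by move=> [N1 N2]; apply/andP; split; apply/negP => ?; [apply: N2|apply: N1]; right.
rewrite andbF; split => // [[N1 N2]]; apply: (IH'.2 _).
by split=> ?; [apply: N1|apply: N2]; left.
Qed.

Definition oneline (n : nat) (s : {perm 'I_n}) : seq nat := [seq val (s i) | i <- enum 'I_n].

(** Passes from increasing maps of positions to subsequences of values; an arbitrary [P] lets both
    patterns share the translation. *)
Lemma subsequence_oneline (n m : nat) (s : {perm 'I_n}) (P : seq nat -> Prop) :
  (exists2 f : {ffun 'I_m -> 'I_n},
     (forall i j : 'I_m, i < j -> f i < f j) & P [seq val (s (f i)) | i <- enum 'I_m]) <->
  (exists q, [/\ subseq q (oneline s), size q = m & P q]).
Proof.
split.
  move=> [f inc_f Pf]; exists [seq val (s (f i)) | i <- enum 'I_m].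
  split=> //; last by rewrite size_map size_enum_ord.
  rewrite (map_comp (fun i => val (s i)) f); apply: map_subseq.
  rewrite (_ : map f (enum 'I_m) = [seq i <- enum 'I_n | i \in map f (enum 'I_m)]).
    exact: filter_subseq.
  have lt_trans : transitive (fun i j : 'I_n => i < j) by move=> x y z; apply: ltn_trans.
  apply: (irr_sorted_eq lt_trans) => [x||| x]; rewrite ?ltnn //.
  - rewrite sorted_map; have := iota_ltn_sorted 0 m; rewrite -val_enum_ord sorted_map.
    by apply: sub_sorted => i j; apply: inc_f.
  - apply: sorted_filter => //; have := iota_ltn_sorted 0 n.
    by rewrite -val_enum_ord sorted_map.
  - by rewrite mem_filter mem_enum andbT.
move=> [q [/subseq_map_inv[p sub_p ->]]]; rewrite size_map => sz_p Pq.
have sort_p : sorted ltn (map val p).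
  apply: (subseq_sorted ltn_trans) (map_subseq val sub_p) _.
  by rewrite val_enum_ord iota_ltn_sorted.
pose f : {ffun 'I_m -> 'I_n} := [ffun i => tnth (in_tuple p) (cast_ord (esym sz_p) i)].
have fE x0 i : f i = nth x0 p i by rewrite ffunE (tnth_nth x0).
exists f; last first.
  suff -> : [seq val (s (f i)) | i <- enum 'I_m] = [seq val (s i) | i <- p] by [].
  rewrite (map_comp (fun i => val (s i)) f); congr map.
  case: p {sub_p sort_p Pq} sz_p f fE => [|x0 p] sz_p f fE.
    by apply: size0nil; rewrite size_map size_enum_ord -sz_p.
  apply: (@eq_from_nth _ x0); first by rewrite size_map size_enum_ord -sz_p.
  move=> i; rewrite size_map size_enum_ord => lt_im;
    rewrite (nth_map (Ordinal lt_im)) ?size_enum_ord //.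
  by rewrite (fE x0) nth_enum_ord.
move=> i j lt_ij; rewrite (fE (f i)) (fE (f i) j).
have := sorted_ltn_nth ltn_trans 0 sort_p i j.
rewrite !inE size_map sz_p !ltn_ord => /(_ isT isT lt_ij).
by rewrite !(nth_map (f i)) // sz_p.
Qed.

Lemma nth_pattern (n m : nat) (s : {perm 'I_n}) (f : {ffun 'I_m -> 'I_n}) (i : 'I_m) :
  nth 0 [seq val (s (f i)) | i <- enum 'I_m] i = s (f i).
Proof. by rewrite (nth_map i) ?size_enum_ord // nth_ord_enum. Qed.

Lemma size_pattern (n m : nat) (s : {perm 'I_n}) (f : {ffun 'I_m -> 'I_n}) :
  size [seq val (s (f i)) | i <- enum 'I_m] = m.
Proof. by rewrite size_map size_enum_ord. Qed.

Lemma contains_incE (n L : nat) (s : {perm 'I_n}) :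
  contains_inc L s <-> bad_inc L (rev (oneline s)).
Proof.
transitivity (exists q, [/\ subseq q (oneline s), size q = L.+1 & sorted ltn q]).
  rewrite -(subsequence_oneline L.+1 s (sorted ltn)); split.
    move=> /existsP[f /forallP Hf]; exists f.
      by move=> i j lt_ij; have /forallP/(_ j) := Hf i; rewrite lt_ij => /andP[].
    rewrite sorted_map; have := iota_ltn_sorted 0 L.+1; rewrite -val_enum_ord sorted_map.
    by apply: sub_sorted => i j /= lt_ij; have /forallP/(_ j) := Hf i; rewrite lt_ij => /andP[].
  move=> [f inc_f sort_f]; apply/existsP; exists f; apply/forallP => i; apply/forallP => j.
  apply/implyP => lt_ij; rewrite inc_f //=.
  have := sorted_ltn_nth ltn_trans 0 sort_f i j.
  rewrite !inE size_pattern !ltn_ord => /(_ isT isT lt_ij).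
  by rewrite !nth_pattern.
split=> [[q [sub_q sz_q sort_q]]|[u [sub_u sort_u sz_u]]].
  exists (rev q); rewrite subseq_rev size_rev; split => //.
  by rewrite rev_sorted.
exists (rev u); split; rewrite ?size_rev //; last by rewrite rev_sorted.
by rewrite -subseq_rev revK.
Qed.

(** For [d = 0] the equivalence fails: [ord0] and [ord_max] coincide, so no map [f] qualifies,
    whereas [bad_dec 0] holds for every nonempty list. *)
Lemma contains_decE (n d : nat) (s : {perm 'I_n}) : 0 < d ->
  contains_dec_then_big d s <-> bad_dec d (rev (oneline s)).
Proof.
case: d => // d _.
have gtn_trans : transitive gtn by move=> x y z /= lt1 lt2; apply: ltn_trans lt1.
pose P q := sorted gtn (take d.+1 q) && (nth 0 q 0 < nth 0 q d.+1).
transitivity (exists q, [/\ subseq q (oneline s), size q = d.+2 & P q]).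
  rewrite -(subsequence_oneline d.+2 s P).
  split.
    move=> /existsP[f /andP[/andP[/forallP inc_f /forallP dec_f] big_f]]; exists f.
      by move=> i j lt_ij; have /forallP/(_ j) := inc_f i; rewrite lt_ij.
    rewrite /P (nth_pattern s f ord0) (nth_pattern s f ord_max) big_f andbT.
    apply/(sortedP 0) => i; rewrite size_takel ?size_pattern // => lt_id.
    have lt_i : i < d.+2 by lia.
    have lt_i1 : i.+1 < d.+2 by lia.
    rewrite !nth_take //; try exact: ltn_trans lt_id.
    rewrite (nth_pattern s f (Ordinal lt_i)) (nth_pattern s f (Ordinal lt_i1)).
    have /forallP/(_ (Ordinal lt_i1)) := dec_f (Ordinal lt_i).
    by move/implyP; apply; rewrite /= ltnSn.
  move=> [f inc_f /andP[sort_f big_f]]; apply/existsP; exists f.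
  rewrite (nth_pattern s f ord0) (nth_pattern s f ord_max) in big_f; rewrite big_f andbT.
  apply/andP; split; apply/forallP => i; apply/forallP => j; apply/implyP.
    exact: inc_f.
  move=> /andP[lt_ij lt_jd].
  have := sorted_ltn_nth gtn_trans 0 sort_f i j.
  rewrite !inE size_takel ?size_pattern // lt_jd (ltn_trans lt_ij) //.
  move=> /(_ isT isT lt_ij); rewrite !nth_take //; last by apply: ltn_trans lt_jd.
  by rewrite !nth_pattern.
split=> [[q [sub_q sz_q /andP[sort_q big_q]]]|[x [u [sub_u sort_u sz_u lt_u]]]].
  exists (nth 0 q d.+1), (rev (take d.+1 q)); split.
  - rewrite -rev_rcons subseq_rev -take_nth ?sz_q // take_oversize ?sz_q //.
  - by rewrite rev_sorted.
  - by rewrite size_rev size_takel ?sz_q.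
  - rewrite all_rev; case: q sort_q big_q sz_q {sub_q} => // y q /=.
    rewrite path_sortedE // => /andP[lt_y _] lt_yq _; rewrite lt_yq /=.
    by apply: sub_all lt_y => z /= lt_zy; apply: ltn_trans lt_yq.
exists (rev (x :: u)); split; rewrite ?size_rev /= ?sz_u //.
  by rewrite -subseq_rev revK.
rewrite /P rev_cons -cats1 take_size_cat ?size_rev ?sz_u // rev_sorted sort_u /=.
have -> : nth 0 (rev u ++ [:: x]) d.+1 = x by rewrite nth_cat size_rev sz_u ltnn subnn.
rewrite nth_cat size_rev sz_u /=.
by apply: (allP lt_u); rewrite -mem_rev mem_nth // size_rev sz_u.
Qed.

(* The number of ways to append [n] further values to a permutation whose insertion tableau has
   lattice word [w] without creating a forbidden pattern. *)
Fixpoint count_ext (d L n : nat) (w : seq nat) : nat :=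
  if n is n'.+1 then
    \sum_(0 <= v < (size w).+1 | has_room d L (take v w)) count_ext d L n' (insert_word w v)
  else 1.

Lemma has_room_ins (d L v : nat) (w : seq nat) : has_room d L (insert_word w v) -> has_room d L w.
Proof.
rewrite /has_room count0_ins => /andP[H1 H2].
have := incr_len_ins_ge 0 (take v w) (drop v w); rewrite cat_take_drop -/(insert_word w v); lia.
Qed.

Lemma bump_word_rcons (c x : nat) (s : seq nat) :
  bump_word c (rcons s x) =
  rcons (bump_word c s) (if x == carry c s then (carry c s).+1 else x).
Proof.
by elim: s c => [|r s IH] c /=; case: eqP => // _; rewrite IH.
Qed.

Lemma ins_rcons (w : seq nat) (v x : nat) : v <= size w ->
  insert_word (rcons w x) v =
  rcons (insert_word w v) (if x == carry 0 (drop v w) then (carry 0 (drop v w)).+1 else x).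
Proof.
move=> le_v; rewrite /insert_word drop_rcons // bump_word_rcons -rcons_cons -rcons_cat.
by rewrite -[in take _ _]cats1 takel_cat.
Qed.

(* A value above which nothing may be appended is irrelevant for the later values. *)
Lemma count_ext_rcons (d L n x : nat) (w : seq nat) :
  ~~ has_room d L (rcons w x) -> count_ext d L n (rcons w x) = count_ext d L n w.
Proof.
elim: n x w => //= n IH x w bad.
(* The last position has the whole word below it and is excluded. Any other insertion keeps a last
   letter, possibly bumped, and by [has_room_ins] the longer word still has no room. *)
rewrite size_rcons big_mkcond big_nat_recr //= take_oversize ?size_rcons //.
rewrite (negPf bad) addn0 -big_mkcond /= big_nat_cond [RHS]big_nat_cond.
apply: eq_big => v; first by case: ltnP => //= le_v; rewrite -cats1 takel_cat.
rewrite andbC => /and3P[_ _ le_v]; rewrite ins_rcons // IH //.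
by rewrite -ins_rcons //; apply: contra bad; apply: has_room_ins.
Qed.

Lemma oneline_lift (n : nat) (v : 'I_n.+1) (s : {perm 'I_n}) :
  oneline (lift_perm ord_max v s) = rcons (map (bump v) (oneline s)) v.
Proof.
rewrite /oneline enum_ordSr map_rcons lift_perm_id -!map_comp.
congr rcons; apply: eq_map => i /=.
have -> : widen_ord (leqnSn n) i = lift ord_max i.
  by apply: ord_inj; rewrite lift_max.
by rewrite lift_perm_lift.
Qed.

(** A permutation of [n+1] points amounts to its last value and the standardised rest, recombined by
    [lift_perm] at [ord_max]; bijectivity follows from injectivity and equal cardinalities. *)
Lemma sum_perm_lift (n : nat) (G : seq nat -> nat) :
  \sum_(s : {perm 'I_n.+1}) G (rev (oneline s)) =
  \sum_(s : {perm 'I_n}) \sum_(0 <= v < n.+1) G (v :: map (bump v) (rev (oneline s))).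
Proof.
pose f (p : {perm 'I_n} * 'I_n.+1) : {perm 'I_n.+1} := lift_perm ord_max p.2 p.1.
have inj_f : injective f.
  move=> [s v] [s' v'] /permP eq_f.
  have := eq_f ord_max; rewrite !lift_perm_id /= => eq_v; subst v'; congr pair.
  apply/permP => i; have := eq_f (lift ord_max i).
  by rewrite !lift_perm_lift => /lift_inj.
have bij_f : bijective f.
  by apply: inj_card_bij => //; rewrite card_prod !card_Sn card_ord factS mulnC.
rewrite (reindex f) /=; last exact: onW_bij.
rewrite [RHS](eq_bigr (fun s : {perm 'I_n} => \sum_(v < n.+1) G (val v :: map (bump v) (rev
  (oneline s)))));
  last by move=> s _; rewrite big_mkord.
rewrite pair_big /=; apply: eq_bigr => [[s v] _].
by rewrite oneline_lift rev_rcons map_rev.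
Qed.

Fixpoint codes (n : nat) : seq (seq nat) :=
  if n is n'.+1 then [seq v :: c | c <- codes n', v <- index_iota 0 n] else [:: [::]].

Lemma codesP (n : nat) (c : seq nat) : c \in codes n -> wf_code c /\ size c = n.
Proof.
elim: n c => [|n IH] c; first by rewrite inE => /eqP ->.
move=> /allpairsP[[c' v] [/IH[wf_c sz_c] in_v ->]] /=.
by move: in_v; rewrite mem_index_iota /= ltnS sz_c wf_c => ->.
Qed.

Lemma sum_codesS (n : nat) (G : seq nat -> nat) :
  \sum_(c <- codes n.+1) G c = \sum_(c <- codes n) \sum_(0 <= v < n.+1) G (v :: c).
Proof. exact: big_allpairs_dep. Qed.

Lemma sum_perm_codes (n : nat) (G : seq nat -> nat) :
  \sum_(s : {perm 'I_n}) G (rev (oneline s)) = \sum_(c <- codes n) G (code_list c).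
Proof.
elim: n G => [|n IH] G.
  rewrite big_seq1 /= (big_pred1 1%g).
    by congr G; apply/size0nil; rewrite size_rev /oneline size_map size_enum_ord.
  by move=> s; apply/esym/eqP/permP => -[].
rewrite sum_perm_lift sum_codesS.
exact: (IH (fun t => \sum_(0 <= v < n.+1) G (v :: map (bump v) t))).
Qed.

(** The parameter [m] lets the induction move one letter at a time from the code to the
    continuation; for [m = 0] the sum counts the good codes. *)
Lemma sum_codes_count_ext (d L n m : nat) :
  \sum_(c <- codes n | good d L c) count_ext d L m (code_word c) = count_ext d L (n + m) [::].
Proof.
elim: n m => [|n IH] m; first by rewrite big_cons big_nil addn0.
rewrite addSnnS -IH big_mkcond sum_codesS [RHS]big_mkcond /=.
rewrite big_seq [RHS]big_seq; apply: eq_bigr => c /codesP[wf_c sz_c].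
rewrite -big_mkcond size_code_word // sz_c; case: (good d L c).
  by apply: eq_bigl => v; rewrite andbT.
by rewrite big_pred0 // => v; rewrite andbF.
Qed.

Lemma card_S_dL (d L n : nat) : 0 < d -> #|S_dL d L n| = count_ext d L n [::].
Proof.
move=> d_gt0; rewrite -[n in RHS]addn0 -sum_codes_count_ext -sum1_card big_mkcond.
pose G t : nat := `[< ~ bad_inc L t /\ ~ bad_dec d t >].
rewrite (eq_bigr (fun s : {perm 'I_n} => G (rev (oneline s)))); last first.
  move=> s _; suff -> : (s \in S_dL d L n) =
      `[< ~ bad_inc L (rev (oneline s)) /\ ~ bad_dec d (rev (oneline s)) >].
    by rewrite /G; case: asboolP.
  rewrite inE -negb_or; apply/idP/asboolP.
    rewrite negb_or => /andP[/negP N1 /negP N2].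
    by split => [/contains_incE|/(contains_decE _ d_gt0)].
  move=> [N1 N2]; apply/norP; split; apply/negP.
    by move/(contains_decE _ d_gt0).
  by move/contains_incE.
rewrite sum_perm_codes [RHS]big_mkcond big_seq [RHS]big_seq /=.
apply: eq_bigr => c /codesP[wf_c _]; rewrite /G.
case: asboolP => [/(good_code_list d L wf_c) ->|] //.
by case: (boolP (good d L c)) => // /(good_code_list d L wf_c).
Qed.

(** * Counting by shape *)

Definition unit_ffun (d : nat) (i : 'I_d) : {ffun 'I_d -> int} := [ffun j => ((j == i)%:Z)%R].

(* A partition [lam] with [d] parts is encoded by the strictly decreasing vector [lam_b - b]. *)
Definition empty_shape (d : nat) : {ffun 'I_d -> int} := [ffun i : 'I_d => (- (nat_of_ord i)%:Z)%R].

Definition valid (d : nat) (x : {ffun 'I_d -> int}) : bool :=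
  [forall i : 'I_d, forall j : 'I_d, (i < j) ==> (x j < x i)%R] &&
  [forall i : 'I_d, empty_shape d i <= x i]%R.

Lemma validP (d : nat) (x : {ffun 'I_d -> int}) :
  reflect ((forall i j : 'I_d, i < j -> (x j < x i)%R) /\
           (forall i : 'I_d, - (nat_of_ord i)%:Z <= x i)%R)
    (valid x).
Proof.
apply: (iffP andP) => [[/'forall_forallP H1 /forallP H2]|[H1 H2]]; split.
- by move=> i j lt_ij; have := H1 i j; rewrite lt_ij.
- by move=> i; have := H2 i; rewrite ffunE.
- by apply/'forall_forallP => i j; apply/implyP; apply: H1.
- by apply/forallP => i; rewrite ffunE.
Qed.

Lemma subvE (d : nat) (x : {ffun 'I_d -> int}) (i j : 'I_d) :
  ((x - unit_ffun i)%R j = x j - (j == i)%:Z)%R.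
Proof. by rewrite !ffunE. Qed.

Lemma addvE (d : nat) (x : {ffun 'I_d -> int}) (i j : 'I_d) :
  ((x + unit_ffun i)%R j = x j + (j == i)%:Z)%R.
Proof. by rewrite !ffunE. Qed.

Lemma valid_empty_shape (d : nat) : valid (empty_shape d).
Proof. by apply/validP; split => [i j lt_ij|i]; rewrite !ffunE; lia. Qed.

Lemma lt_not_both (d : nat) (i a b : 'I_d) : a < b -> ~~ ((a == i) && (b == i)).
Proof. by move=> lt_ab; apply/negP => /andP[/eqP Ea /eqP Eb]; rewrite Ea Eb ltnn in lt_ab. Qed.

Lemma neq_not_both (d : nat) (a i j : 'I_d) : i != j -> ~~ ((a == i) && (a == j)).
Proof. by move=> /negPf ne_ij; apply/negP => /andP[/eqP -> ]; rewrite ne_ij. Qed.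

(** Cells in distinct rows do not interfere: a condition violated by one of the moves alone stays
    violated after both. This is the commutation of adding and removing cells in Young's lattice. *)
Lemma valid_move (d : nat) (x : {ffun 'I_d -> int}) (i j : 'I_d) : i != j -> valid x ->
  valid (x + unit_ffun j - unit_ffun i)%R -> valid (x + unit_ffun j)%R && valid (x - unit_ffun i)%R.
Proof.
move=> ne_ij /validP[dec_x pos_x] /validP[dec_y pos_y].
apply/andP; split; apply/validP; split => [a b lt_ab|a].
- have := dec_y a b lt_ab; have := dec_x a b lt_ab; rewrite subvE !addvE subvE !addvE.
  have := lt_not_both i lt_ab.
  have := lt_not_both j lt_ab.
  have := neq_not_both a ne_ij.
  have := neq_not_both b ne_ij.
  by case: (a == i); case: (b == i); case: (a == j); case: (b == j) => //=; lia.
- by have := pos_x a; rewrite addvE; lia.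
- have := dec_y a b lt_ab; have := dec_x a b lt_ab; rewrite subvE !addvE subvE !addvE !subvE.
  have := lt_not_both i lt_ab.
  have := lt_not_both j lt_ab.
  have := neq_not_both a ne_ij.
  have := neq_not_both b ne_ij.
  by case: (a == i); case: (b == i); case: (a == j); case: (b == j) => //=; lia.
- have := pos_y a; have := pos_x a; rewrite subvE addvE subvE.
  have := neq_not_both a ne_ij.
  by case: (a == i); case: (a == j) => //=; lia.
Qed.

(** Both sides say that row [i] is longer than row [i+1], that is [x (i+1) + 1 < x i]. *)
Lemma valid_sub_widen (d : nat) (x : {ffun 'I_d.+1 -> int}) (i : 'I_d) : valid x ->
  valid (x - unit_ffun (widen_ord (leqnSn d) i))%R = valid (x + unit_ffun (lift ord0 i))%R.
Proof.
set i0 := widen_ord _ _; set i1 := lift _ _ => /validP[dec_x pos_x].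
have vi0 : i0 = i :> nat by [].
have vi1 : i1 = i.+1 :> nat by [].
have lt01 : i0 < i1 by rewrite vi0 vi1.
have eq0 (a : 'I_d.+1) : (a == i0) = (a == i :> nat) by [].
have eq1 (a : 'I_d.+1) : (a == i1) = (a == i.+1 :> nat) by [].
have ge0 (a : 'I_d.+1) : a < i0 -> (x i0 < x a)%R by exact: dec_x.
have le1 (a : 'I_d.+1) : i1 < a -> (x a < x i1)%R by exact: dec_x.
have eqx0 (a : 'I_d.+1) : a = i :> nat -> x a = x i0 by move=> E; congr (x _); apply: val_inj.
have eqx1 (a : 'I_d.+1) : a = i.+1 :> nat -> x a = x i1 by move=> E; congr (x _); apply: val_inj.
transitivity (x i1 + 1 < x i0)%R.
  apply/validP/idP => [[dec_y _]|lt_x].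
    by have := dec_y _ _ lt01; rewrite !subvE !eq0; lia.
  split => [a b lt_ab|a].
    rewrite !subvE !eq0; have := dec_x _ _ lt_ab.
    have := eqx0 a; have := eqx0 b; have := eqx1 b; have := le1 b.
    by rewrite ?vi1; case: (ltngtP b i.+1); case: eqP; case: eqP; lia.
  by rewrite subvE eq0; have := pos_x a; have := eqx0 a; have := pos_x i1; case: eqP; lia.
apply/idP/validP => [lt_x|[dec_y _]].
  split => [a b lt_ab|a]; last by rewrite addvE; have := pos_x a; lia.
  rewrite !addvE !eq1; have := dec_x _ _ lt_ab.
  have := eqx1 a; have := eqx1 b; have := eqx0 a; have := ge0 a.
  by rewrite ?vi0; case: (ltngtP a i); case: eqP; case: eqP; lia.
by have := dec_y _ _ lt01; rewrite !addvE !eq1; lia.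
Qed.

(** The lattice words of shape [x]; the last letter is the row of the largest entry, whose removal
    must leave a partition. That [k] is the size of [x] is not tested here but assumed as
    [shape_size x = k] in the lemmas that need it. *)
Fixpoint words (d k : nat) (x : {ffun 'I_d -> int}) : seq (seq nat) :=
  if k is k'.+1 then
    flatten [seq [seq rcons w (nat_of_ord i) | w <- words k' (x - unit_ffun i)%R]
            | i : 'I_d <- enum 'I_d & valid (x - unit_ffun i)%R]
  else [:: [::]].

Lemma sum_wordsS (d k : nat) (x : {ffun 'I_d -> int}) (g : seq nat -> nat) :
  \sum_(w <- words k.+1 x) g w =
  \sum_(i < d | valid (x - unit_ffun i)%R) \sum_(w <- words k (x - unit_ffun i)%R) g (rcons w i).
Proof.
rewrite /= big_flatten big_map big_filter big_enum_cond /=.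
by apply: eq_bigr => i _; rewrite big_map.
Qed.

Lemma words_ind (d : nat) (P : nat -> {ffun 'I_d -> int} -> seq nat -> Prop) :
  (forall x, P 0 x [::]) ->
  (forall k x i w, valid (x - unit_ffun i)%R -> w \in words k (x - unit_ffun i)%R ->
     P k (x - unit_ffun i)%R w -> P k.+1 x (rcons w i)) ->
  forall k x w, w \in words k x -> P k x w.
Proof.
move=> P0 PS; elim=> [|k IH] x w; first by rewrite inE => /eqP ->.
case/flatten_mapP => i; rewrite mem_filter => /andP[val_i _] /mapP[w' in_w ->].
by apply: PS => //; apply: IH.
Qed.

Lemma size_words (d k : nat) (x : {ffun 'I_d -> int}) (w : seq nat) :
  w \in words k x -> size w = k.
Proof.
by move: k x w; apply: words_ind => // k x i w _ _ eq_sz; rewrite size_rcons eq_sz.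
Qed.

Definition shape_size (d : nat) (x : {ffun 'I_d ->
  int}) : int := (\sum_i (x i - empty_shape d i))%R.

Lemma sum_unit_ffun (d : nat) (i : 'I_d) : (\sum_j unit_ffun i j = 1)%R.
Proof.
rewrite (bigD1 i) //= big1 ?ffunE ?eqxx ?addr0 // => j ne_ji.
by rewrite ffunE (negPf ne_ji).
Qed.

Lemma shape_size_sub (d : nat) (x : {ffun 'I_d -> int}) (i : 'I_d) :
  shape_size (x - unit_ffun i)%R = (shape_size x - 1)%R.
Proof.
rewrite /shape_size -(sum_unit_ffun i) -sumrB; apply: eq_bigr => j _.
by rewrite subvE [unit_ffun i j]ffunE addrAC.
Qed.

Lemma shape_size_add (d : nat) (x : {ffun 'I_d -> int}) (i : 'I_d) :
  shape_size (x + unit_ffun i)%R = (shape_size x + 1)%R.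
Proof. by have := shape_size_sub (x + unit_ffun i)%R i; rewrite addrK => ->; rewrite subrK. Qed.

Lemma shape_size_empty_shape (d : nat) : shape_size (empty_shape d) = 0%R.
Proof. by rewrite /shape_size big1 // => i _; rewrite subrr. Qed.

Lemma shape_size0 (d : nat) (x : {ffun 'I_d -> int}) : valid x -> shape_size x = 0%R ->
  x = empty_shape d.
Proof.
move=> /validP[_ pos_x] lev0; apply/ffunP => i; apply/eqP; rewrite -subr_eq0.
have /eqP := lev0; rewrite psumr_eq0 => [|j _]; last by rewrite subr_ge0 ffunE.
by move/allP/(_ i); rewrite mem_index_enum; apply.
Qed.

Lemma carry_rcons (c x : nat) (s : seq nat) :
  carry c (rcons s x) = if x == carry c s then (carry c s).+1 else carry c s.
Proof. by elim: s c => [|r s IH] c /=; rewrite ?IH. Qed.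

Lemma valid_sub_max (d : nat) (x : {ffun 'I_d.+1 -> int}) (i : 'I_d.+1) :
  x ord_max = (- d%:Z)%R -> valid (x - unit_ffun i)%R -> i != ord_max.
Proof.
move=> x_max /validP[_ pos]; apply/eqP => Ei; have := pos ord_max.
by rewrite subvE x_max Ei eqxx /=; lia.
Qed.

(* Row insertion is invertible: a lattice word [w] together with an insertion position [v] amounts
   to a lattice word of a shape with one more cell, that cell being in the row of the final
     carry. *)
Lemma sum_words_ins (d k : nat) (x : {ffun 'I_d.+1 -> int}) (g : seq nat -> nat -> nat) :
  valid x -> x ord_max = (- d%:Z)%R ->
  shape_size x = k%:Z%R ->
  \sum_(w <- words k x) \sum_(0 <= v < k.+1) g (insert_word w v) (carry 0 (drop v w)) =
  \sum_(j < d.+1 | valid (x + unit_ffun j)%R) \sum_(w <- words k.+1 (x + unit_ffun j)%R) g w j.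
Proof.
have [n] := ubnP k; elim: n k x g => // n IHn k x g lt_kn val_x x_max x_0.
pose B (i j : 'I_d.+1) :=
  \sum_(w <- words k (x + unit_ffun j - unit_ffun i)%R)
    g (rcons w (nat_of_ord i)) (nat_of_ord j).
have not_last i : valid (x - unit_ffun i)%R -> i != ord_max by exact: valid_sub_max.
have add0 : valid (x + unit_ffun ord0)%R.
  move/validP: val_x => [dec_x pos_x]; apply/validP; split => [a b lt_ab|a]; rewrite !addvE.
    have -> : (b == ord0) = false by apply/eqP => E; rewrite E in lt_ab.
    by have := dec_x _ _ lt_ab; lia.
  by have := pos_x a; lia.
(* The words whose last letter is the added row itself. The addable rows are row [0] and the rows
   just below a removable one; the last row, being empty, is never removable. *)
have diag :
  \sum_(j < d.+1 | valid (x + unit_ffun j)%R) \sum_(w <- words k x) g (rcons w (nat_of_ord j)) j =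
  \sum_(w <- words k x) g (rcons w 0) 0 +
  \sum_(i < d.+1 | valid (x - unit_ffun i)%R) \sum_(w <- words k x) g (rcons w i.+1) i.+1.
  rewrite big_mkcond big_ord_recl add0; congr addn.
  rewrite [RHS]big_mkcond big_ord_recr /=.
  case: ifP => [/not_last/eqP //|_]; rewrite addn0.
  by apply: eq_bigr => i _; rewrite valid_sub_widen.
have RHSE :
  \sum_(j < d.+1 | valid (x + unit_ffun j)%R) \sum_(w <- words k.+1 (x + unit_ffun j)%R) g w j =
  \sum_(j < d.+1 | valid (x + unit_ffun j)%R) \sum_(w <- words k x) g (rcons w (nat_of_ord j)) j +
  \sum_(j < d.+1 | valid (x + unit_ffun j)%R)
    \sum_(i < d.+1 | valid (x + unit_ffun j - unit_ffun i)%R && (i != j)) B i j.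
  rewrite -big_split /=; apply: eq_bigr => j val_j.
  by rewrite sum_wordsS (bigD1 j) /= ?addrK.
rewrite {}RHSE {}diag.
have BE i j : B i j =
    \sum_(w <- words k (x + unit_ffun j - unit_ffun i)%R)
      g (rcons w (nat_of_ord i)) (nat_of_ord j) by [].
clearbody B.
case: k lt_kn x_0 BE => [|k] lt_kn lev_x BE.
  have x_0 := shape_size0 val_x lev_x.
  have no_sub i : valid (x - unit_ffun i)%R = false.
    by apply/negP; rewrite x_0 => /validP[_ /(_ i)]; rewrite subvE eqxx ffunE; lia.
  rewrite big_seq1 big_nat1 big_seq1 [X in _ = _ + X + _]big_pred0 // addn0.
  rewrite [X in _ = _ + X]big1 ?addn0 // => j _; rewrite big_pred0 // => i.
  apply/negP => /andP[val_ij ne_ij]; have := valid_move ne_ij val_x val_ij.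
  by rewrite no_sub andbF.
(* Fomin's local rule at the last letter [i]: if it equals the carry, both are raised by one;
   otherwise both stay. *)
pose G (i : 'I_d.+1) u c := if nat_of_ord i == c then g (rcons u c.+1) c.+1 else g (rcons u i) c.
(* The extra position [v = k+1] puts a [0] at the end and bumps nothing; it accounts for the
   diagonal term of row [0]. *)
rewrite (eq_big_seq (fun w =>
    \sum_(0 <= v < k.+1) g (insert_word w v) (carry 0 (drop v w)) + g (rcons w 0) 0)); last first.
  move=> w in_w; have sz_w := @size_words _ k.+1 x w in_w; rewrite big_nat_recr //=;
    congr (_ + g _ _).
    by rewrite /insert_word take_oversize ?drop_oversize ?sz_w //= cats1.
  by rewrite drop_oversize ?sz_w.
rewrite big_split /= [LHS]addnC -addnA; congr addn.
rewrite sum_wordsS.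
rewrite [LHS] (eq_bigr (fun i : 'I_d.+1 => \sum_(w <- words k.+1 x) g (rcons w i.+1) i.+1 +
    \sum_(j < d.+1 | valid (x + unit_ffun j - unit_ffun i)%R && (i != j)) B i j)); last first.
  move=> i val_i.
  transitivity (\sum_(w <- words k (x - unit_ffun i)%R)
      \sum_(0 <= v < k.+1) G i (insert_word w v) (carry 0 (drop v w))).
    apply: eq_big_seq => w /size_words sz_w; apply: eq_big_nat => v /andP[_ lt_v].
    rewrite ins_rcons ?drop_rcons ?sz_w // carry_rcons /G.
    by case: eqP => // ->.
  (* In the smaller shape, adding the cell back in row [i] gives the diagonal term of row [i+1], and
     adding it in another row [j] gives [B i j]. *)
  rewrite IHn //; last first.
  - by rewrite shape_size_sub lev_x; lia.
  - by rewrite subvE x_max eq_sym (negPf (not_last _ val_i)) subr0.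
  rewrite (bigD1 i) /= ?subrK //; congr addn.
    by apply: eq_bigr => w _; rewrite /G eqxx.
  apply: eq_big => j; first by rewrite addrAC [i == j]eq_sym.
  by move=> /andP[_ ne_ji]; rewrite BE addrAC; apply: eq_bigr => w _; rewrite /G;
    case: eqP => // /val_inj E; rewrite E eqxx in ne_ji.
rewrite big_split /=; congr addn.
(* By [valid_move], removing then adding and adding then removing range over the same pairs of
   distinct rows. *)
rewrite (exchange_big_dep (fun j => valid (x + unit_ffun j)%R)) /=; last first.
  by move=> i j _ /andP[val_ij ne_ij]; case/andP: (valid_move ne_ij val_x val_ij).
apply: eq_bigr => j val_j; apply: eq_bigl => i.
case: (boolP (valid _ && (i != j))) => [/andP[val_ij ne_ij]|]; last by rewrite andbF.
by case/andP: (valid_move ne_ij val_x val_ij) => _ ->.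
Qed.

Lemma incr_len_le_bound (m p : nat) (s : seq nat) : all (ltn^~ m) s -> incr_len p s <= m - p.
Proof.
elim: s p => //= r s IH p /andP[lt_rm lt_s].
by have := IH p lt_s; have := IH r.+1 lt_s; case: (leqP p r); lia.
Qed.

Lemma incr_len_iota (p r : nat) (s : seq nat) : subseq (iota p r) s -> r <= incr_len p s.
Proof.
elim: s p r => [|a s IH] p r; first by rewrite subseq0 -size_eq0 size_iota => /eqP ->.
case: r => // r /=; case: eqP => [<-|_] sub_s.
  by rewrite leqnn leq_max ltnS (IH _ _ sub_s) ?orbT.
have := IH p r.+1 sub_s; case: (leqP p a); lia.
Qed.

Lemma incr_len_cat_l (m : nat) (u s : seq nat) : incr_len m u <= incr_len m (u ++ s).
Proof. by elim: u m => //= r u IH m; have := IH m; have := IH r.+1; case: (leqP m r); lia. Qed.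

Lemma has_room_take (d L v : nat) (w : seq nat) : has_room d L w -> has_room d L (take v w).
Proof.
rewrite /has_room -{1 2}(cat_take_drop v w) count_cat => /andP[lt_d lt_L].
rewrite (leq_ltn_trans (incr_len_cat_l 0 _ _) lt_d) /=.
exact: leq_ltn_trans (leq_addr _ _) lt_L.
Qed.

Lemma count0_words (d k : nat) (x : {ffun 'I_d.+1 -> int}) (w : seq nat) :
  w \in words k x -> valid x -> shape_size x = k%:Z%R -> (count_mem 0 w)%:Z%R = x ord0.
Proof.
move: k x w; apply: words_ind => [x val_x lev_x|k x i w val_i _ IH val_x lev_x].
  by rewrite (shape_size0 val_x lev_x) ffunE.
rewrite -cats1 count_cat PoszD IH //; last by rewrite shape_size_sub lev_x; lia.
by rewrite subvE /= addn0 eq_sym; case: (i == ord0) / eqP => [->|/eqP ne];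
  rewrite ?subrK ?subr0 ?addr0 //=;
   move: ne; rewrite -val_eqE /= => /negPf ->; rewrite addr0.
Qed.

Lemma all_words_lt (d k : nat) (x : {ffun 'I_d.+1 -> int}) (w : seq nat) :
  w \in words k x -> x ord_max = (- d%:Z)%R -> all (ltn^~ d) w.
Proof.
move: k x w; apply: words_ind => // k x i w val_i _ IH x_max.
have ne_i := valid_sub_max x_max val_i.
rewrite all_rcons IH /=; last by rewrite subvE eq_sym (negPf ne_i) subr0.
by rewrite andbT ltn_neqAle -ltnS ltn_ord andbT; apply: contra ne_i => /eqP Ei; apply/eqP/val_inj.
Qed.

(** Every prefix of a lattice word has a partition as its shape, so row [i] opens only after row
    [i-1]; the letters opening the rows [0, ..., i] form the subsequence. *)
Lemma words_iota (d k : nat) (x : {ffun 'I_d.+1 -> int}) (w : seq nat) :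
  w \in words k x -> valid x -> shape_size x = k%:Z%R ->
  forall i : 'I_d.+1, (- (nat_of_ord i)%:Z < x i)%R -> subseq (iota 0 i.+1) w.
Proof.
move: k x w; apply: words_ind => [x val_x lev_x i|k x j w val_j _ IH val_x lev_x i lt_i].
  by rewrite (shape_size0 val_x lev_x) ffunE ltxx.
have {}IH : forall i : 'I_d.+1, (- (nat_of_ord i)%:Z < (x - unit_ffun j) i)%R ->
  subseq (iota 0 i.+1) w.
  by apply: IH => //; rewrite shape_size_sub lev_x; lia.
case: (ltP (- (nat_of_ord i)%:Z)%R ((x - unit_ffun j)%R i)) => [/IH sub_w|le_i].
  exact: subseq_trans sub_w (subseq_rcons _ _).
have eq_ij : i = j by apply/eqP; move: le_i; rewrite subvE; case: eqP => //; lia.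
subst j; rewrite -addn1 iotaD add0n.
rewrite -[rcons w _]cats1; apply: cat_subseq; last by rewrite /= eqxx.
case: (posnP i) => [->|i_gt0]; first exact: sub0seq.
have lt_i1 : i.-1 < d.+1 by have := ltn_ord i; lia.
rewrite -[X in iota 0 X](prednK i_gt0); apply: (IH (Ordinal lt_i1)).
have /validP[/(_ (Ordinal lt_i1) i) dec_x _] := val_x.
have {}dec_x : (x i < x (Ordinal lt_i1))%R by apply: dec_x => /=; lia.
have ne : (Ordinal lt_i1 == i) = false by apply/eqP => /(congr1 val) /=; lia.
rewrite subvE ne subr0 /=; apply: le_lt_trans dec_x.
suff low (y : int) : (- (nat_of_ord i)%:Z < y -> - i.-1%:Z <= y)%R by exact: low.
by move: i_gt0; lia.
Qed.

Definition room_shape (d L : nat) (x : {ffun 'I_d.+1 -> int}) : bool :=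
  ((x ord_max == - d%:Z) && (x ord0 < L%:Z))%R.

(** A nonempty last row yields the increasing subsequence [0 1 ... d]; an empty one leaves only
    letters below [d]. *)
Lemma has_room_words (d L k : nat) (x : {ffun 'I_d.+1 -> int}) (w : seq nat) :
  valid x -> shape_size x = k%:Z%R -> w \in words k x -> has_room d.+1 L w = room_shape L x.
Proof.
move=> val_x lev_x in_w; rewrite /has_room /room_shape -(count0_words in_w) // ltz_nat; congr andb.
apply/idP/eqP => [lt_d|x_max].
  apply/eqP; rewrite eq_le; have /validP[_ /(_ ord_max) ->] := val_x.
  rewrite andbT leNgt; apply/negP => lt_max.
  by have := incr_len_iota (words_iota in_w val_x lev_x lt_max); rewrite leqNgt lt_d.
by have := incr_len_le_bound 0 (all_words_lt in_w x_max); rewrite subn0.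
Qed.

Definition shape_count (d L n k : nat) (x : {ffun 'I_d.+1 -> int}) : nat :=
  \sum_(w <- words k x) count_ext d.+1 L n w.

(** Without room the largest entry is irrelevant by [count_ext_rcons], and for [n = 0] every word
    counts once; in both cases the last letter can be deleted. *)
Lemma shape_count_remove (d L n k : nat) (x : {ffun 'I_d.+1 -> int}) :
  valid x -> shape_size x = k.+1%:Z%R -> (n == 0) || ~~ room_shape L x ->
  shape_count L n k.+1 x = \sum_(i < d.+1 | valid (x - unit_ffun i)%R) shape_count L n k (x -
    unit_ffun i)%R.
Proof.
move=> val_x lev_x; case: n => [|n] /= bad; first by rewrite /shape_count sum_wordsS.
rewrite /shape_count; transitivity (\sum_(w <- words k.+1 x) count_ext d.+1 L n.+1 (take k w)).
  apply: eq_big_seq => w in_w; have sz_w : size w = k.+1 by exact: size_words in_w.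
  have := has_room_words L val_x lev_x in_w; case/lastP: w sz_w {in_w} => // w a.
  rewrite size_rcons => -[sz_w] okE; rewrite count_ext_rcons ?okE //.
  by rewrite -cats1 take_size_cat.
rewrite sum_wordsS; apply: eq_bigr => i _; apply: eq_big_seq => w in_w.
have sz_w : size w = k by exact: size_words in_w.
by rewrite -cats1 take_size_cat.
Qed.

(** Room for the whole word makes every insertion position admissible, so the bijection
    [sum_words_ins] applies. *)
Lemma shape_count_add (d L n k : nat) (x : {ffun 'I_d.+1 -> int}) :
  valid x -> shape_size x = k%:Z%R -> room_shape L x ->
  shape_count L n.+1 k x = \sum_(i < d.+1 | valid (x + unit_ffun i)%R) shape_count L n k.+1 (x +
    unit_ffun i)%R.
Proof.
move=> val_x lev_x ok_x; have /andP[/eqP x_max _] := ok_x.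
rewrite /shape_count -(sum_words_ins (fun w _ => count_ext d.+1 L n w)) //.
apply: eq_big_seq => w in_w /=; rewrite (size_words in_w).
by apply: eq_bigl => v; rewrite has_room_take // (has_room_words L val_x lev_x in_w).
Qed.

Lemma card_S_dL_shape (d L n : nat) :
  #|S_dL d.+1 L n| = shape_count L n 0 (empty_shape d.+1).
Proof. by rewrite card_S_dL // /shape_count big_seq1. Qed.

(** * Slater determinants at roots of unity *)

Section Spectral.
Local Open Scope ring_scope.
Variables (C : numClosedFieldType) (d M : nat) (w : C).
Hypothesis prim_w : M.-primitive_root w.

Definition root_char (a : nat) (t : int) : C := w ^ (a%:Z * t).

Lemma w_neq0 : w != 0.
Proof.
apply/eqP => w0; have := prim_expr_order prim_w.
by rewrite w0 expr0n (gtn_eqF (prim_order_gt0 prim_w)) => /eqP; rewrite eq_sym oner_eq0.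
Qed.

Lemma root_charD (a : nat) (s t : int) : root_char a (s + t) = root_char a s * root_char a t.
Proof. by rewrite /root_char mulrDr expfzDr ?w_neq0. Qed.

Lemma root_char0 (a : nat) : root_char a 0 = 1.
Proof. by rewrite /root_char mulr0 expr0z. Qed.

Lemma wM (t : int) : w ^ (M%:Z * t) = 1.
Proof. by rewrite -exprz_exp -exprnP prim_expr_order // exp1rz. Qed.

Lemma root_char_period (a : nat) (s t : int) : root_char a (s + M%:Z * t) = root_char a s.
Proof. by rewrite root_charD {2}/root_char mulrCA wM mulr1. Qed.

Lemma conj_w : w^* = w^-1.
Proof.
have nw : `|w| = 1.
  apply/eqP; rewrite -(@pexpr_eq1 _ _ M) ?normr_ge0 ?(prim_order_gt0 prim_w) //.
  by rewrite -normrX prim_expr_order // normr1.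
by rewrite invC_norm nw expr1n invr1 mul1r.
Qed.

Lemma root_char_conj (a : nat) (t : int) : (root_char a t)^* = root_char a (- t).
Proof. by rewrite /root_char fmorphXz /= conj_w exprz_inv mulrN. Qed.

Lemma expw_eq1 (t : int) : (w ^ t == 1) = (M %| t)%Z.
Proof.
rewrite {1}(divz_eq t M%:Z) addrC expfzDr ?w_neq0 // mulrC [_ * M%:Z]mulrC wM mul1r.
have M_neq0 : M%:Z != 0 by rewrite -lt0n (prim_order_gt0 prim_w).
have := modz_ge0 t M_neq0; have := ltz_pmod t (prim_order_gt0 prim_w : (0 < M%:Z)).
case E: (t %% M%:Z)%Z => [r|//] lt_r _.
rewrite -exprnP -(prim_order_dvd prim_w) [RHS](_ : _ = (t %% M%:Z == 0)%Z); last first.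
  by apply/dvdz_mod0P/eqP.
by rewrite E /dvdn modn_small.
Qed.

Lemma sum_root_char (t : int) : \sum_(a < M) root_char a t = if (M %| t)%Z then M%:R else 0.
Proof.
rewrite (eq_bigr (fun a : 'I_M => (w ^ t) ^+ a)); last first.
  by move=> a _; rewrite /root_char mulrC -exprz_exp exprnP.
rewrite -expw_eq1; case: eqP => [->|/eqP ne1].
  by rewrite (eq_bigr (fun _ => 1)) ?sumr_const ?card_ord // => a _; rewrite expr1n.
apply: (mulfI (_ : w ^ t - 1 != 0)); first by rewrite subr_eq0.
by rewrite -subrX1 mulr0 exprnP exprz_exp mulrC wM subrr.
Qed.

Definition slater (j : {ffun 'I_d -> 'I_M}) (x : {ffun 'I_d -> int}) : C :=
  \det (\matrix_(a, b) root_char (j a) (x b)).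

Definition psum (j : {ffun 'I_d -> 'I_M}) (t : int) : C := \sum_a root_char (j a) t.

(** In the Leibniz expansion, the extra character of row [a] raises the exponent of column [s a] by
    [t]; the sum over [a] thus becomes a sum over columns. *)
Lemma psum_slater (j : {ffun 'I_d -> 'I_M}) (t : int) (x : {ffun 'I_d -> int}) :
  psum j t * slater j x = \sum_b slater j (x + [ffun c => t * unit_ffun b c]).
Proof.
rewrite /slater /determinant exchange_big mulr_sumr /=; apply: eq_bigr => s _.
rewrite [RHS](reindex_inj (@perm_inj _ s)) mulr_suml; apply: eq_bigr => a _.
rewrite mulrCA; congr (_ * _).
rewrite [RHS](bigD1 a) //= [in LHS](bigD1 a) //= /unit_ffun !mxE !ffunE eqxx mulr1.
rewrite root_charD mulrA [root_char _ t * _]mulrC; congr (_ * _).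
apply: eq_bigr => i ne_ia; rewrite /unit_ffun !mxE !ffunE (inj_eq perm_inj) (negPf ne_ia).
by rewrite mulr0 addr0.
Qed.

Lemma slater_add (j : {ffun 'I_d -> 'I_M}) (x : {ffun 'I_d -> int}) :
  psum j 1 * slater j x = \sum_b slater j (x + unit_ffun b).
Proof.
rewrite psum_slater; apply: eq_bigr => b _; congr (slater j (x + _)).
by apply/ffunP => c; rewrite ffunE mul1r.
Qed.

Lemma slater_sub (j : {ffun 'I_d -> 'I_M}) (x : {ffun 'I_d -> int}) :
  psum j (- 1) * slater j x = \sum_b slater j (x - unit_ffun b).
Proof.
rewrite psum_slater; apply: eq_bigr => b _; congr (slater j (x + _)).
by apply/ffunP => c; rewrite !ffunE mulN1r.
Qed.

Lemma slater_collision (j : {ffun 'I_d -> 'I_M}) (x : {ffun 'I_d -> int}) (a b : 'I_d) (t : int) :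
  a != b -> x b = x a + M%:Z * t -> slater j x = 0.
Proof.
move=> ne_ab xb; rewrite /slater -det_tr; apply: (determinant_alternate ne_ab) => i.
by rewrite !mxE xb root_char_period.
Qed.

Lemma slater_eq0 (j : {ffun 'I_d -> 'I_M}) (x : {ffun 'I_d -> int}) :
  ~~ injectiveb j -> slater j x = 0.
Proof.
move=> /injectivePn[a [b ne_ab eq_j]].
by apply: (determinant_alternate ne_ab) => i; rewrite !mxE eq_j.
Qed.

(** The integer points of an open alcove of the affine symmetric group; their entries are distinct
    modulo [M]. *)
Definition alcove (x : {ffun 'I_d -> int}) :=
  forall a b : 'I_d, (a < b)%N -> x b < x a < x b + M%:Z.

Lemma alcove_dist (x : {ffun 'I_d -> int}) (a b : 'I_d) :
  alcove x -> `|x a - x b| < M%:Z.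
Proof.
move=> alc; have M_gt0 := prim_order_gt0 prim_w.
by case: (ltngtP a b) => [/alc|/alc|/val_inj ->]; lia.
Qed.

Lemma alcove_rank (x : {ffun 'I_d -> int}) (a : 'I_d) :
  alcove x -> nat_of_ord a = #|[set b | x a < x b]|.
Proof.
move=> alc.
have inj_w : injective (widen_ord (ltnW (ltn_ord a))).
  by move=> i k /(congr1 val) /= /val_inj.
rewrite -[LHS]card_ord -(card_imset _ inj_w).
apply: eq_card => b; rewrite inE; apply/imsetP/idP => [[c _ ->]|lt_ab].
  by case/andP: (alc (widen_ord (ltnW (ltn_ord a)) c) a (ltn_ord c)).
have lt_b : (b < a)%N.
  by case: (ltngtP b a) => [//|/alc|/val_inj E]; [lia|rewrite E ltxx in lt_ab].
by exists (Ordinal lt_b) => //; apply: val_inj.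
Qed.

(** The quotients of the differences by [M] sum to zero, and any two differ by at most one because
    each vector spreads over less than [M]; hence all vanish. The ranks of the entries then identify
    the permutations. *)
Lemma alcove_match (x y : {ffun 'I_d -> int}) (s t : {perm 'I_d}) :
  alcove x -> alcove y -> shape_size x = shape_size y ->
  [forall i, (M %| (x (s i) - y (t i)))%Z] = (x == y) && (s == t).
Proof.
move=> alc_x alc_y lev; apply/forallP/andP => [dvd|[/eqP -> /eqP ->] i]; last first.
  by rewrite subrr dvdz0.
have M_gt0 := prim_order_gt0 prim_w.
have sum0 : \sum_i (x (s i) - y (t i)) = 0.
  have sum_perm (z : {ffun 'I_d -> int}) (u : {perm 'I_d}) : \sum_i z (u i) = \sum_i z i.
    by rewrite [RHS](reindex_inj (@perm_inj _ u)).
  rewrite sumrB !sum_perm.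
  apply/eqP; rewrite subr_eq0; apply/eqP.
  by move: lev; rewrite /shape_size !big_split /= => /addIr.
pose m i := ((x (s i) - y (t i)) %/ M%:Z)%Z.
have mE i : x (s i) - y (t i) = m i * M%:Z by rewrite divzK.
have m_near i k : m i <= m k + 1.
  have := alcove_dist (s i) (s k) alc_x; have := alcove_dist (t i) (t k) alc_y.
  by have := mE i; have := mE k; nia.
have sum_m : \sum_i m i = 0.
  by apply: (mulIf (_ : M%:Z != 0)); [lia|rewrite mul0r mulr_suml -(eq_bigr _ (fun i _ => mE i))].
have m0 i : m i = 0.
  case: (ltrgt0P (m i)) => // [pos|neg].
    have : 0 < \sum_k m k.
      by rewrite (bigD1 i) //= ltr_pwDl // sumr_ge0 // => k _; have := m_near i k; lia.
    by rewrite sum_m.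
  have : \sum_k - m k > 0.
    by rewrite (bigD1 i) //= ltr_pwDl ?oppr_gt0 // sumr_ge0 // => k _; have := m_near k i; lia.
  by rewrite sumrN sum_m oppr0.
have eq_xy i : x (s i) = y (t i) by apply/eqP; rewrite -subr_eq0 mE m0 mul0r.
have eq_st : s = t.
  apply/permP => i; apply: val_inj => /=; rewrite (alcove_rank _ alc_x) (alcove_rank _ alc_y).
  rewrite -[LHS](card_preimset _ (@perm_inj _ s)) -[RHS](card_preimset _ (@perm_inj _ t)).
  by apply: eq_card => k; rewrite !inE !eq_xy.
split; last exact/eqP.
by apply/eqP/ffunP => i; have := eq_xy (s^-1%g i); rewrite -eq_st permKV.
Qed.

(** Once both determinants are expanded, the sum over [j] factors into character sums, which vanish
    unless [M] divides every exponent difference. By [alcove_match] only equal shapes with equal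
    permutations remain. *)
Lemma slater_orthogonal (x y : {ffun 'I_d -> int}) :
  alcove x -> alcove y -> shape_size x = shape_size y ->
  \sum_j slater j x * (slater j y)^* = if x == y then (d`! * M ^ d)%:R else 0.
Proof.
move=> alc_x alc_y lev.
have expand j : slater j x * (slater j y)^* =
    \sum_(s : {perm 'I_d}) \sum_(t : {perm 'I_d}) (-1) ^+ s * (-1) ^+ t *
      \prod_i root_char (j i) (x (s i) - y (t i)).
  rewrite /slater /determinant rmorph_sum mulr_suml; apply: eq_bigr => s _.
  rewrite mulr_sumr; apply: eq_bigr => t _; rewrite rmorphM rmorphXn rmorphN1 rmorph_prod.
  rewrite mulrACA -big_split /=; congr (_ * _); apply: eq_bigr => i _.
  by rewrite !mxE root_char_conj -root_charD.
rewrite (eq_bigr _ (fun j _ => expand j)) exchange_big /=.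
under eq_bigr => s _.
  rewrite exchange_big /=.
  under eq_bigr => t _.
    rewrite -mulr_sumr -(bigA_distr_bigA (fun i (a : 'I_M) => root_char a (x (s i) - y (t i)))) /=.
    under eq_bigr => i _ do rewrite sum_root_char.
    over.
  over.
have prodE (s t : {perm 'I_d}) :
    \prod_i (if (M %| (x (s i) - y (t i)))%Z then M%:R else 0 : C) =
    if (x == y) && (s == t) then M%:R ^+ d else 0.
  rewrite -(alcove_match s t alc_x alc_y lev); case: ifP => [/forallP dvd|/negbT].
    by rewrite (eq_bigr (fun _ => M%:R)) ?prodr_const ?card_ord // => i _; rewrite dvd.
  by rewrite negb_forall => /existsP[i ndvd]; rewrite (bigD1 i) //= (negPf ndvd) mul0r.
under eq_bigr => s _ do under eq_bigr => t _ do rewrite prodE.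
case: eqP => _ /=; last by rewrite big1 // => s _; rewrite big1 // => t _; rewrite mulr0.
rewrite (eq_bigr (fun _ => M%:R ^+ d)).
  by rewrite sumr_const card_Sn natrM natrX mulr_natl.
move=> s _; rewrite (bigD1 s) //= eqxx big1 ?addr0.
  by rewrite -expr2 sqrr_sign mul1r.
by move=> t ne_ts; rewrite eq_sym (negPf ne_ts) mulr0.
Qed.

End Spectral.

(** * Moments of the determinants and the count by shape *)

Section Moments.
Local Open Scope ring_scope.
Variables (C : numClosedFieldType) (d L : nat) (w : C).
Let M := (d.+1 + L)%N.
Hypothesis L_gt0 : (0 < L)%N.
Hypothesis prim_w : M.-primitive_root w.

(** [psum w j (- 1)] is the conjugate of [psum w j 1], so the [n]-th power is one of a squared
    modulus. The exponent [k] stands for the size of [x]: the [k]-th power removes [k] cells before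
    the comparison with the empty shape. *)
Definition moment (n k : nat) (x : {ffun 'I_d.+1 -> int}) : C :=
  \sum_(j : {ffun 'I_d.+1 -> 'I_M}) psum w j (- 1) ^+ k * (psum w j 1 * psum w j (- 1)) ^+ n *
     (slater w j x * (slater w j (empty_shape d.+1))^*).

Lemma moment_remove (n k : nat) (x : {ffun 'I_d.+1 -> int}) :
  moment n k.+1 x = \sum_i moment n k (x - unit_ffun i).
Proof.
rewrite /moment exchange_big; apply: eq_bigr => j _ /=.
rewrite -mulr_sumr -mulr_suml -(slater_sub prim_w) exprS; ring.
Qed.

Lemma moment_add (n k : nat) (x : {ffun 'I_d.+1 -> int}) :
  moment n.+1 k x = \sum_i moment n k.+1 (x + unit_ffun i).
Proof.
rewrite /moment exchange_big; apply: eq_bigr => j _ /=.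
rewrite -mulr_sumr -mulr_suml -(slater_add prim_w) !exprS; ring.
Qed.

Lemma moment_collision (n k : nat) (x : {ffun 'I_d.+1 -> int}) (a b : 'I_d.+1) (t : int) :
  a != b -> x b = x a + M%:Z * t -> moment n k x = 0.
Proof.
move=> ne_ab xb; rewrite /moment big1 // => j _.
by rewrite (slater_collision prim_w _ ne_ab xb) mul0r mulr0.
Qed.

Lemma alcove_empty_shape : alcove M (empty_shape d.+1).
Proof. by move=> a b lt_ab; rewrite !ffunE; have := ltn_ord b; rewrite /M; lia. Qed.

Lemma moment0 (x : {ffun 'I_d.+1 -> int}) : alcove M x -> shape_size x = 0 ->
  moment 0 0 x = if x == empty_shape d.+1 then ((d.+1)`! * M ^ d.+1)%:R else 0.
Proof.
move=> alc_x lev_x; rewrite -(slater_orthogonal prim_w alc_x alcove_empty_shape)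
  ?shape_size_empty_shape //.
by apply: eq_bigr => j _; rewrite !expr0 !mul1r.
Qed.

Lemma valid_alcove (x : {ffun 'I_d.+1 -> int}) : valid x -> x ord0 <= L%:Z -> alcove M x.
Proof.
move=> /validP[dec_x pos_x] le_L a b lt_ab; rewrite dec_x //=.
have le_a : x a <= x ord0.
  by case: (posnP a) => [a0|a_gt0]; [rewrite (_ : a = ord0) //; apply: val_inj|apply: ltW;
    apply: dec_x].
by have := pos_x b; have := ltn_ord b; rewrite /M; lia.
Qed.

Lemma alcove_gap (y : {ffun 'I_d.+1 -> int}) (a b : 'I_d.+1) :
  alcove M y -> (a <= b)%N -> y b + b%:Z <= y a + a%:Z.
Proof.
move=> alc_y; case: b => b lt_b /= le_ab; elim: b lt_b le_ab => [|b IH] lt_b le_ab.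
  by rewrite (_ : a = Ordinal lt_b) //; apply: val_inj => /=; lia.
case: (ltngtP a b.+1) le_ab => // [lt_ab _|eq_ab _]; last first.
  by rewrite (_ : a = Ordinal lt_b) //; apply: val_inj.
have lt_b' : (b < d.+1)%N by lia.
have := IH lt_b' lt_ab; have /andP[] := alc_y (Ordinal lt_b') (Ordinal lt_b) (ltnSn b).
by lia.
Qed.

(** A step that stays in the alcove but leaves the partitions takes a cell from an empty last row.
    Lack of room then forces a first row of length [L], and the extreme entries would differ by
    [M]. *)
Lemma alcove_sub_valid (x : {ffun 'I_d.+1 -> int}) (i : 'I_d.+1) :
  valid x -> x ord0 <= L%:Z -> ~~ room_shape L x -> alcove M (x - unit_ffun i) ->
    valid (x - unit_ffun i).
Proof.
move=> val_x le_L nok alc_i; have /validP[_ pos_x] := val_x.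
apply/validP; split; first by move=> a b /alc_i /andP[].
move=> a; rewrite leNgt; apply/negP => neg_a.
have ai : a = i by apply/eqP; move: neg_a (pos_x a); rewrite subvE; case: eqP => //; lia.
have gap := alcove_gap alc_i (leq_ord a : (a <= ord_max)%N).
have i_max : i = ord_max.
  apply/eqP/negPn/negP => ne; have := pos_x ord_max; move: gap neg_a.
  by rewrite !subvE eq_sym (negPf ne) /=; lia.
have x_max : x ord_max = - d%:Z.
  by have := pos_x ord_max; move: neg_a; rewrite ai i_max subvE eqxx /=; lia.
have x_0 : x ord0 = L%:Z by move: nok; rewrite /room_shape x_max eqxx /=; lia.
case: (posnP d) => [d0|d_gt0].
  have : ord0 = ord_max :> 'I_d.+1 by apply: val_inj => /=; rewrite d0.
  by move=> E; move: x_max; rewrite -E x_0; lia.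
have /andP[_] := alc_i ord0 ord_max d_gt0.
have ne0 : (ord0 == i) = false by rewrite i_max -val_eqE /=; lia.
by rewrite !subvE ne0 i_max eqxx x_max x_0 /M; lia.
Qed.

(* A step out of the alcove makes two entries collide modulo [M]. *)
Lemma alcove_sub (n k : nat) (x : {ffun 'I_d.+1 -> int}) (i : 'I_d.+1) :
  alcove M x -> alcove M (x - unit_ffun i) \/ moment n k (x - unit_ffun i) = 0.
Proof.
move=> alc_x.
case: (pselect (alcove M (x - unit_ffun i))) => [|nalc]; [by left|right].
have [[a b]] : exists p : 'I_d.+1 * 'I_d.+1, (p.1 < p.2)%N /\
   ~~ ((x - unit_ffun i) p.2 < (x - unit_ffun i) p.1 < (x - unit_ffun i) p.2 + M%:Z).
  apply: contrapT => no; apply: nalc => a b lt_ab; apply/negPn/negP => bad.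
  by apply: no; exists (a, b).
move=> /= [lt_ab]; rewrite !subvE => bad; have := alc_x a b lt_ab => alc_ab.
have := lt_not_both i lt_ab => nb.
have ne_ab : a != b by apply/eqP => E; rewrite E ltnn in lt_ab.
have [Eb|Eb] : x a - (a == i)%:Z = x b - (b == i)%:Z \/
               x a - (a == i)%:Z = x b - (b == i)%:Z + M%:Z.
- move: nb bad alc_ab; rewrite /M; case: (a == i); case: (b == i) => //=; lia.
- by apply: (@moment_collision _ _ _ a b 0) => //; rewrite !subvE; lia.
- by apply: (@moment_collision _ _ _ a b (- 1)) => //; rewrite !subvE; lia.
Qed.

Let N := ((d.+1)`! * M ^ d.+1)%N.

(* Without the positivity condition the walk down the alcove may leave the partitions, but it
   then never comes back to the empty one, so orthogonality gives [0]. *)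
Lemma moment_level (k : nat) (x : {ffun 'I_d.+1 -> int}) :
  alcove M x -> x ord0 <= L%:Z -> shape_size x = k%:Z ->
  moment 0 k x = if valid x then (shape_count L 0 k x * N)%:R else 0.
Proof.
elim: k x => [|k IH] x alc_x le_L lev_x.
  rewrite moment0 //; case: eqP => [->|ne]; last first.
    by case: ifP => // val_x; case: ne; apply: shape_size0.
  by rewrite valid_empty_shape /shape_count big_seq1 mul1n.
rewrite moment_remove; case: (boolP (valid x)) => [val_x|nval].
  rewrite (shape_count_remove val_x) // big_distrl /= natr_sum.
  rewrite [RHS]big_mkcond; apply: eq_bigr => i _.
  have lev_i : shape_size (x - unit_ffun i) = k%:Z by rewrite shape_size_sub lev_x; lia.
  have le_i : (x - unit_ffun i) ord0 <= L%:Z by rewrite subvE; lia.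
  case: (boolP (valid (x - unit_ffun i))) => [val_i|nval_i].
    by rewrite IH ?val_i //; apply: valid_alcove.
  case: (@alcove_sub 0 k x i alc_x) => [alc_i|//].
  by rewrite IH // (negPf nval_i).
rewrite big1 // => i _.
case: (@alcove_sub 0 k x i alc_x) => [alc_i|//].
rewrite IH //; [|by rewrite subvE; lia|by rewrite shape_size_sub lev_x; lia].
case: ifP => // val_i; case/negP: nval; apply/validP; split.
  by move=> a b /alc_x /andP[].
by move=> a; have /validP[_ /(_ a)] := val_i; rewrite subvE; lia.
Qed.

(** A cell added outside the partitions makes two exponents equal, so its determinants vanish; room
    keeps the other shapes within [L] columns. *)
Lemma moment_ok (n k : nat) (x : {ffun 'I_d.+1 -> int}) :
  (forall (k : nat) (x : {ffun 'I_d.+1 -> int}),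
     valid x -> x ord0 <= L%:Z -> shape_size x = k%:Z ->
     moment n k x = (shape_count L n k x * N)%:R) ->
  valid x -> shape_size x = k%:Z -> room_shape L x ->
  moment n.+1 k x = (shape_count L n.+1 k x * N)%:R.
Proof.
move=> IHn val_x lev_x ok_x; have /andP[/eqP x_max lt_L] := ok_x.
rewrite moment_add (shape_count_add _ val_x lev_x ok_x) big_distrl /= natr_sum.
rewrite [RHS]big_mkcond; apply: eq_bigr => i _.
case: ifP => [val_i|nval_i].
  by apply: IHn => //; [rewrite addvE; lia|rewrite shape_size_add lev_x; lia].
have /validP[dec_x pos_x] := val_x.
have [[a b]] : exists p : 'I_d.+1 * 'I_d.+1, (p.1 < p.2)%N /\
   ~~ ((x + unit_ffun i) p.2 < (x + unit_ffun i) p.1).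
  apply: contrapT => no; case/negP: (negbT nval_i); apply/validP; split => [a b lt_ab|a].
    by apply/negPn/negP => bad; apply: no; exists (a, b).
  by have := pos_x a; rewrite addvE; lia.
move=> /= [lt_ab]; rewrite !addvE => bad; have := dec_x a b lt_ab => dec_ab.
have nb := lt_not_both i lt_ab.
have ne_ab : a != b by apply/eqP => E; rewrite E ltnn in lt_ab.
apply: (@moment_collision _ _ _ a b 0) => //; rewrite !addvE.
by move: nb bad dec_ab; case: (a == i); case: (b == i) => //=; lia.
Qed.

(** Induction on [n], then on [k]: with room, adding a cell lowers [n]; without room, removing one
    lowers [k]. For [k = 0] the shape is empty and has room since [L > 0]. *)
Lemma shape_count_moment (n k : nat) (x : {ffun 'I_d.+1 -> int}) :
  valid x -> x ord0 <= L%:Z -> shape_size x = k%:Z ->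
  moment n k x = (shape_count L n k x * N)%:R.
Proof.
elim: n k x => [|n IHn] k x val_x le_L lev_x.
  by rewrite moment_level ?val_x //; apply: valid_alcove.
have alc_x := valid_alcove val_x le_L.
elim: k x val_x le_L lev_x alc_x => [|k IHk] x val_x le_L lev_x alc_x;
  case: (boolP (room_shape L x)) => ok_x; first last.
- rewrite moment_remove (shape_count_remove val_x lev_x) ?ok_x ?orbT // big_distrl /= natr_sum.
  rewrite [RHS]big_mkcond; apply: eq_bigr => i _.
  case: ifP => [val_i|/negbT nval_i].
    have le_i : (x - unit_ffun i) ord0 <= L%:Z by rewrite subvE; lia.
    by apply: IHk => //; [rewrite shape_size_sub lev_x; lia|apply: valid_alcove].
  case: (@alcove_sub n.+1 k x i alc_x) => [alc_i|//].
  by rewrite alcove_sub_valid in nval_i.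
- exact: (moment_ok IHn).
- by rewrite (shape_size0 val_x lev_x) /room_shape !ffunE eqxx ltz_nat L_gt0 in ok_x.
- exact: (moment_ok IHn).
Qed.

End Moments.

(** * Extremal sums of roots of unity *)

#[local] Bind Scope ring_scope with R.
#[local] Arguments cos x%_ring_scope.
#[local] Arguments sin x%_ring_scope.

Section RealTrig.
Local Open Scope ring_scope.

Lemma cosD (x y : R) : cos (x + y) = cos x * cos y - sin x * sin y.
Proof. exact: cos_plus. Qed.

Lemma sinD (x y : R) : sin (x + y) = sin x * cos y + cos x * sin y.
Proof. exact: sin_plus. Qed.

Lemma sinB (x y : R) : sin (x - y) = sin x * cos y - cos x * sin y.
Proof. exact: sin_minus. Qed.

Lemma cos2sin2 (x : R) : cos x ^+ 2 + sin x ^+ 2 = 1.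
Proof. by rewrite -[RHS](sin2_cos2 x) /Rsqr RplusE !RmultE; ring. Qed.

Lemma sin_pi_gt0 (x : R) : 0 < x -> x < PI -> 0 < sin x.
Proof. by move=> /RltP x_gt0 /RltP x_lt; apply/RltP/sin_gt_0. Qed.

Lemma PI_pos : 0 < PI :> R.
Proof. exact/RltP/PI_RGT_0. Qed.

Definition sqnorm (z : R[i]) : R := complex.Re z ^+ 2 + complex.Im z ^+ 2.

Lemma sqnormM (y z : R[i]) : sqnorm (y * z) = sqnorm y * sqnorm z.
Proof. by case: y z => [a b] [c e]; rewrite /sqnorm /=; ring. Qed.

Lemma sqnorm1 : sqnorm 1 = 1.
Proof. by rewrite /sqnorm /= expr1n expr0n addr0. Qed.

Lemma sqnormX (z : R[i]) (n : nat) : sqnorm (z ^+ n) = sqnorm z ^+ n.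
Proof. by elim: n => [|n IH]; rewrite ?expr0 ?sqnorm1 // !exprS sqnormM IH. Qed.

Lemma sqnorm_prod (I : finType) (P : pred I) (F : I -> R[i]) :
  sqnorm (\prod_(i | P i) F i) = \prod_(i | P i) sqnorm (F i).
Proof. by rewrite (big_morph _ sqnormM sqnorm1). Qed.

Lemma sqnormN (z : R[i]) : sqnorm (- z) = sqnorm z.
Proof. by case: z => a b; rewrite /sqnorm /=; ring. Qed.

Lemma sqnorm_ge0 (z : R[i]) : 0 <= sqnorm z.
Proof. by rewrite addr_ge0 ?sqr_ge0. Qed.

Lemma mul_conj_sqnorm (z : R[i]) : z * z^* = (sqnorm z)%:C%C.
Proof. by case: z => a b; rewrite /sqnorm /=; apply/eqP; rewrite eq_complex /=; apply/andP;
  split; apply/eqP; ring. Qed.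

Lemma sqnorm_conj (z : R[i]) : sqnorm z^* = sqnorm z.
Proof. by case: z => a b; rewrite /sqnorm /=; ring. Qed.

Variable M : nat.

Definition half_angle (t : nat) : R := PI * t%:R / M%:R.

Definition omega : R[i] := (cos (2 * half_angle 1) +i* sin (2 * half_angle 1))%C.

Lemma half_angleS (t : nat) : half_angle t.+1 = half_angle t + half_angle 1.
Proof. by rewrite /half_angle -addn1 natrD; ring. Qed.

Lemma omegaX (k : nat) : omega ^+ k = (cos (2 * half_angle k) +i* sin (2 * half_angle k))%C.
Proof.
elim: k => [|k IH].
  by rewrite /half_angle !(mulr0, mul0r) expr0 cos_0 sin_0.
rewrite exprSr IH half_angleS mulrDr cosD sinD /omega.
by apply/eqP; rewrite eq_complex /=; apply/andP; split; apply/eqP; ring.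
Qed.

Lemma sqnorm_omega : sqnorm omega = 1.
Proof. by rewrite /sqnorm /omega /= cos2sin2. Qed.

Lemma sqnorm_omegaX_sub1 (k : nat) : sqnorm (omega ^+ k - 1) = 4 * sin (half_angle k) ^+ 2.
Proof.
rewrite omegaX (_ : 2 * half_angle k = half_angle k + half_angle k); last by ring.
rewrite cosD sinD /sqnorm /=.
have := cos2sin2 (half_angle k); set c := cos _; set s := sin _ => cs.
have -> : (c * c - s * s - 1) ^+ 2 + (s * c + c * s - 0) ^+ 2 =
  (c ^+ 2 + s ^+ 2 - 1) ^+ 2 + 4 * s ^+ 2 by ring.
by rewrite cs; ring.
Qed.

Hypothesis M_gt1 : (1 < M)%N.

Lemma sin_half_angle_gt0 (k : nat) : (0 < k < M)%N -> 0 < sin (half_angle k).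
Proof.
move=> /andP[k_gt0 lt_kM]; have M0 : 0 < M%:R :> R by rewrite ltr0n; lia.
apply: sin_pi_gt0; first by rewrite /half_angle divr_gt0 // mulr_gt0 ?PI_pos ?ltr0n.
by rewrite /half_angle ltr_pdivrMr // ltr_pM2l ?PI_pos // ltr_nat.
Qed.

Lemma prim_omega : M.-primitive_root omega.
Proof.
have M0 : M%:R != 0 :> R by rewrite pnatr_eq0; lia.
rewrite /primitive_root_of_unity; apply/andP; split; first by lia.
apply/forallP => i; rewrite unity_rootE.
case: (ltngtP i.+1 M) (ltn_ord i) => // [lt_i|->] _; last first.
  rewrite omegaX (_ : 2 * half_angle M = 2 * PI); last by rewrite /half_angle mulfK.
  by rewrite cos_2PI sin_2PI eqxx.
rewrite eqbF_neg; apply/eqP => e1; have := sqnorm_omegaX_sub1 i.+1.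
rewrite e1 subrr /sqnorm /= expr0n addr0 => /esym/eqP.
by rewrite mulf_eq0 expf_eq0 /= (gt_eqF (sin_half_angle_gt0 _)) ?lt_i // pnatr_eq0.
Qed.

End RealTrig.

Section Circle.
Local Open Scope ring_scope.
Variable M : nat.
Hypothesis M_gt1 : (1 < M)%N.
Notation w := (omega M).

Definition dot_complex (y z : R[i]) : R :=
  complex.Re y * complex.Re z + complex.Im y * complex.Im z.

Lemma sqnorm_sub_add (y u v : R[i]) :
  sqnorm (y - u + v) = sqnorm y - 2 * (dot_complex y u - dot_complex y v) + sqnorm (u - v).
Proof. by case: y u v => [a b] [c e] [f g]; rewrite /sqnorm /dot_complex /=; ring. Qed.

Lemma sqnorm_eq0 (z : R[i]) : (sqnorm z == 0) = (z == 0).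
Proof. by rewrite eq_complex /sqnorm /= paddr_eq0 ?sqr_ge0 // !expf_eq0. Qed.

Lemma dot_complexN (y z : R[i]) : dot_complex (- y) z = - dot_complex y z.
Proof. by case: y z => [a b] [c e]; rewrite /dot_complex /=; ring. Qed.

(* A sinusoid minus a constant is a homogeneous quadratic form in the cosine and sine of the
   half angle, so its values at four points satisfy a linear relation whose coefficients are
   products of sines of half-angle differences with alternating signs. *)
Lemma no_alternation (y : R[i]) (p q r s : nat) : (p < q < r)%N -> (r < s < M)%N ->
  dot_complex y (w ^+ q) < dot_complex y (w ^+ p) ->
    dot_complex y (w ^+ q) < dot_complex y (w ^+ r) ->
  dot_complex y (w ^+ s) < dot_complex y (w ^+ p) ->
    dot_complex y (w ^+ s) < dot_complex y (w ^+ r) -> False.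
Proof.
move=> /andP[lt_pq lt_qr] /andP[lt_rs lt_sM] qp qr sp sr.
(* With this threshold [f] is nonnegative at [p] and [r] and negative at [q] and [s], so the two
   sides of [id0] have opposite signs. *)
pose k := Num.min (dot_complex y (w ^+ p)) (dot_complex y (w ^+ r)).
pose c t := cos (half_angle M t); pose s' t := sin (half_angle M t).
pose f t := (complex.Re y * (c t ^+ 2 - s' t ^+ 2) + 2 * complex.Im y * (c t * s' t))
  - k * (c t ^+ 2 + s' t ^+ 2).
have fE t : f t = dot_complex y (w ^+ t) - k.
  rewrite /f /dot_complex omegaX (_ : 2 * half_angle M t = half_angle M t + half_angle M t);
    last by ring.
  by rewrite cosD sinD /= cos2sin2 -/(c t) -/(s' t); ring.
pose br a b := s' b * c a - c b * s' a.
have br_gt0 a b : (a < b < M)%N -> 0 < br a b.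
  move=> /andP[lt_ab lt_bM]; rewrite /br -sinB.
  have -> : half_angle M b - half_angle M a = half_angle M (b - a).
    by rewrite /half_angle -{1}(subnK (ltnW lt_ab)) natrD; ring.
  by apply: sin_half_angle_gt0; lia.
have id0 : f p * (br q r * br q s * br r s) + f r * (br p q * br p s * br q s) =
           f q * (br p r * br p s * br r s) + f s * (br p q * br p r * br q r).
  by rewrite /f /br; ring.
have fp : 0 <= f p by rewrite fE subr_ge0 ge_min lexx.
have fr : 0 <= f r by rewrite fE subr_ge0 ge_min lexx orbT.
have fq : f q < 0 by rewrite fE subr_lt0 lt_min qp.
have fs : f s < 0 by rewrite fE subr_lt0 lt_min sp.
have lt_pr := ltn_trans lt_pq lt_qr; have lt_qs := ltn_trans lt_qr lt_rs.
have lt_ps := ltn_trans lt_pr lt_rs.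
have lt_rM := ltn_trans lt_rs lt_sM; have lt_qM := ltn_trans lt_qr lt_rM.
have [Bpq Bpr Bps] : [/\ 0 < br p q, 0 < br p r & 0 < br p s].
  by split; apply: br_gt0; apply/andP.
have [Bqr Bqs Brs] : [/\ 0 < br q r, 0 < br q s & 0 < br r s].
  by split; apply: br_gt0; apply/andP.
have : 0 <= f p * (br q r * br q s * br r s) + f r * (br p q * br p s * br q s).
  by rewrite addr_ge0 // mulr_ge0 // ltW // !mulr_gt0.
by rewrite id0 leNgt -oppr_gt0 opprD addr_gt0 // -mulNr mulr_gt0 ?oppr_gt0 // !mulr_gt0.
Qed.

Lemma sqnorm_omega_sub_gt0 (a b : 'I_M) : a != b -> 0 < sqnorm (w ^+ a - w ^+ b).
Proof.
move=> ne_ab; rewrite lt0r sqnorm_ge0 andbT sqnorm_eq0 subr_eq0.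
by rewrite (eq_prim_root_expr (prim_omega M_gt1)) !modn_small.
Qed.

End Circle.

(** If [0] is outside [J], then [J] is an interval starting at its least element. If [0] is in [J],
    the complement is an interval from [p] to [s], and [J] wraps around from [s+1]. A gap in either
    interval would give an alternation starting at [0]. *)
Lemma cyclic_interval (M D : nat) (J : {set 'I_M}) :
  0 < D < M -> #|J| = D ->
  (forall p q r s : 'I_M, p < q < r -> r < s -> p \in J -> q \notin J -> r \in J -> s \in J) ->
  (forall p q r s : 'I_M, p < q < r -> r < s -> p \notin J -> q \in J -> r \notin J ->
    s \notin J) ->
  exists r : 'I_M, forall x, x \in J -> (x + M - r) %% M < D.
Proof.
move=> /andP[D_gt0 lt_DM] cJ altJ altJ'.
have M_gt0 : 0 < M by lia.
pose o := Ordinal M_gt0.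
have interval_le (K : {set 'I_M}) (p s : 'I_M) : p <= s ->
    (forall q : 'I_M, p <= q <= s -> q \in K) -> s - p < #|K|.
  move=> le_ps sub_K.
  have ltM (i : 'I_(s - p).+1) : p + i < M by have := ltn_ord i; have := ltn_ord s; lia.
  pose f (i : 'I_(s - p).+1) := Ordinal (ltM i).
  have inj_f : injective f by move=> i k /(congr1 val) /= /addnI /val_inj.
  rewrite -[X in X <= _](card_ord (s - p).+1) -cardsT -(card_imset _ inj_f).
  apply: subset_leq_card; apply/subsetP => _ /imsetP[i _ ->].
  by apply: sub_K => /=; have := ltn_ord i; lia.
case: (boolP (o \in J)) => oJ.
  have [c0 c0P] : exists c, c \in ~: J.
    by apply/card_gt0P; rewrite cardsCs setCK cJ card_ord; lia.
  have [p pJ p_min] := arg_minnP (fun c : 'I_M => val c) c0P.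
  have [s sJ s_max] := arg_maxnP (fun c : 'I_M => val c) c0P.
  have le_ps : p <= s by apply: p_min.
  have {}pJ : p \notin J by have : p \in ~: J := pJ; rewrite inE.
  have {}sJ : s \notin J by have : s \in ~: J := sJ; rewrite inE.
  have p_gt0 : 0 < p.
    by rewrite lt0n; apply: contraNN pJ => /eqP p0; rewrite (_ : p = o) //; apply: val_inj.
  have notin q : q \in J -> q < p \/ s < q.
    move=> qJ; case: (ltngtP q p) => [|lt_pq|/val_inj E]; [by left| |by rewrite -E qJ in pJ].
    case: (ltngtP q s) => [lt_qs||/val_inj E]; [|by right|by rewrite -E qJ in sJ].
    by move: sJ; rewrite (altJ o p q s) ?p_gt0.
  have : s - p < #|~: J|.
    apply: interval_le => // q /andP[le_pq le_qs]; rewrite inE; apply/negP => /notin; lia.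
  have cJC : #|~: J| = M - D by rewrite cardsCs setCK cJ card_ord.
  have le_c : #|~: J| <= (s - p).+1.
    have ltM (c : 'I_M) : (c - p) %% (s - p).+1 < (s - p).+1 by rewrite ltn_mod.
    rewrite -[X in _ <= X]card_ord -(card_in_imset (f := fun c => Ordinal (ltM c))).
      exact: max_card.
    move=> c c' cJc c'Jc /(congr1 val) /=.
    have /= h1 := p_min _ cJc; have /= h2 := p_min _ c'Jc.
    have /= h3 := s_max _ cJc; have /= h4 := s_max _ c'Jc.
    rewrite (@modn_small (c - p)); last by lia.
    by rewrite modn_small; [move=> E; apply: val_inj => /=; lia|lia].
  rewrite cJC => lt_c.
  (* The reduction matters when [s] is the last index: the arc then starts at [0]. *)
  have lt_r : s.+1 %% M < M by rewrite ltn_mod.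
  exists (Ordinal lt_r) => x xJ /=.
  have := notin x xJ; have := ltn_ord x; have := ltn_ord s => lt_s lt_x.
  case: (ltngtP s.+1 M) => [lt_sM||eq_sM]; [|lia|]; last first.
    by rewrite eq_sM modnn subn0 modnDr modn_small //; lia.
  rewrite (modn_small lt_sM) => -[lt_xp|lt_sx]; first by rewrite modn_small; lia.
  by rewrite -(addnBAC _ lt_sx) modnDr modn_small; lia.
have [c0 c0P] : exists c, c \in J by apply/card_gt0P; rewrite cJ.
have [p pJ p_min] := arg_minnP (fun c : 'I_M => val c) c0P.
exists p => x xJ; have le_px := p_min _ xJ.
rewrite -addnBAC // modnDr modn_small; last by have := ltn_ord x; lia.
rewrite -cJ; apply: interval_le => // q /andP[le_pq le_qx]; apply: contraT => qJ.
have lt_pq : p < q by rewrite ltn_neqAle le_pq andbT; apply: contra qJ => /eqP/val_inj <-.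
have lt_qx : q < x by rewrite ltn_neqAle le_qx andbT; apply: contra qJ => /eqP/val_inj ->.
have p_gt0 : 0 < p.
  by rewrite lt0n; apply: contraNN oJ => /eqP p0; rewrite (_ : o = p) //; apply: val_inj.
by have := altJ' o p q x; rewrite p_gt0 lt_pq xJ => /(_ isT lt_qx oJ pJ qJ).
Qed.

(** * The maximisers are arcs of consecutive roots *)

Section Arcs.
Local Open Scope ring_scope.
Variables d L : nat.
Hypothesis L_gt0 : (0 < L)%N.
Notation M := (d.+1 + L)%N.
Notation w := (omega M).
Notation conf := {ffun 'I_d.+1 -> 'I_M}.

Let M_gt1 : (1 < M)%N. Proof. by lia. Qed.
Let w_prim := prim_omega M_gt1.

Definition sum_sqnorm (j : conf) : R := sqnorm (psum w j 1).

Lemma psum1 (j : conf) : psum w j 1 = \sum_a w ^+ j a.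
Proof. by apply: eq_bigr => a _; rewrite /root_char mulr1 -exprnP. Qed.

Lemma arc_subproof (r : 'I_M) (s : {perm 'I_d.+1}) (a : 'I_d.+1) : ((r + s a) %% M < M)%N.
Proof. by rewrite ltn_mod addSn. Qed.

Definition circ_arc (r : 'I_M) (s : {perm 'I_d.+1}) : conf :=
  [ffun a => Ordinal (arc_subproof r s a)].

Lemma omega_arc (r : 'I_M) (s : {perm 'I_d.+1}) (a : 'I_d.+1) :
  w ^+ circ_arc r s a = w ^+ r * w ^+ s a.
Proof. by rewrite ffunE /= (prim_expr_mod w_prim) exprD. Qed.

(** Rotation by [w ^+ r] keeps the modulus, and the factor [w - 1] turns the geometric sum into
    [w ^+ d.+1 - 1]. *)
Lemma sum_sqnorm_arc (r : 'I_M) (s : {perm 'I_d.+1}) :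
  sum_sqnorm (circ_arc r s) = (sin (half_angle M d.+1) / sin (half_angle M 1)) ^+ 2.
Proof.
have s1_gt0 : 0 < sin (half_angle M 1) by apply: sin_half_angle_gt0 => //; lia.
have nw : sqnorm (w - 1) = 4 * sin (half_angle M 1) ^+ 2 by rewrite -sqnorm_omegaX_sub1 expr1.
have nw0 : sqnorm (w - 1) != 0 by rewrite nw mulf_neq0 ?expf_neq0 ?pnatr_eq0 // gt_eqF.
apply: (mulfI nw0); rewrite /sum_sqnorm psum1 (eq_bigr _ (fun a _ => omega_arc r s a)).
have -> : \sum_a w ^+ r * w ^+ s a = w ^+ r * \sum_(a < d.+1) w ^+ a.
  by rewrite mulr_sumr [RHS](reindex_inj (@perm_inj _ s)).
rewrite sqnormM sqnormX sqnorm_omega expr1n mul1r -sqnormM -subrX1 sqnorm_omegaX_sub1 nw expr_div_n.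
by field; rewrite gt_eqF.
Qed.

Lemma circ_arc_inj (r r' : 'I_M) (s s' : {perm 'I_d.+1}) : circ_arc r s = circ_arc r' s' ->
  r = r' /\ s = s'.
Proof.
move=> eq_arc.
have eq_mod a : (r + s a = r' + s' a %[mod M])%N.
  by have /ffunP/(_ a)/(congr1 val) := eq_arc; rewrite !ffunE.
have lt_s (u : {perm 'I_d.+1}) a : (u a < M)%N by have := ltn_ord (u a); lia.
have eq_r : r = r'.
  have := eq_mod (s^-1%g ord0); rewrite permKV /= addn0.
  (* If the root [r] sat at position [t+1] of the second arc, its predecessor would lie in both
     arcs, at a position [u] of the first with [u+1] divisible by [M]; but [u+1 <= d+1 < M]. *)
  case E: (nat_of_ord (s' (s^-1%g ord0))) => [|t] eq_t.
    by apply: val_inj; move: eq_t; rewrite addn0 !modn_small.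
  have lt_t : (t < d.+1)%N by have := ltn_ord (s' (s^-1%g ord0)); rewrite E; lia.
  have := eq_mod (s'^-1%g (Ordinal lt_t)); rewrite permKV /=.
  set u := s _ => eq_u; have lt_u := ltn_ord u.
  have : (r + (u.+1) = r + 0 %[mod M])%N.
    by rewrite addn0 eq_t addnS -addn1 -modnDml eq_u modnDml addn1 addnS.
  by move/eqP; rewrite eqn_modDl mod0n modn_small //; lia.
split=> //; apply/permP => a; apply: val_inj => /=.
by have /eqP := eq_mod a; rewrite eq_r eqn_modDl !modn_small // => /eqP.
Qed.

(* Exchanging one point of a maximiser for a point outside shows that the linear form given by the
   sum itself separates the two sets, so they cannot alternate four times around the circle. *)
Lemma exchange_arc (j : conf) : injective j ->
  (forall j' : conf, injective j' -> sum_sqnorm j' <= sum_sqnorm j) ->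
  exists r s, j = circ_arc r s.
Proof.
move=> inj_j j_max; pose y := psum w j 1.
pose J := [set j a | a : 'I_d.+1].
have sep (a b : 'I_M) : a \in J -> b \notin J -> dot_complex y (w ^+ b) < dot_complex y (w ^+ a).
  move=> /imsetP[i _ ->] bJ; pose j' : conf := [ffun k => if k == i then b else j k].
  have inj_j' : injective j'.
    move=> k k'; rewrite !ffunE; case: eqP => [->|_]; case: eqP => [->|_] //.
    - by move=> E; case/negP: bJ; rewrite E imset_f.
    - by move=> E; case/negP: bJ; rewrite -E imset_f.
    - exact: inj_j.
  have psum_j' : psum w j' 1 = y - w ^+ j i + w ^+ b.
    rewrite /y !psum1 (bigD1 i) //= [in RHS](bigD1 i) //= ffunE eqxx.
    rewrite (eq_bigr (fun k => w ^+ j k)); first by ring.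
    by move=> k ne_ki; rewrite ffunE (negPf ne_ki).
  have ne : j i != b by apply: contraNneq bJ => <-; rewrite imset_f.
  (* With [u] and [v] the exchanged roots, [|y - u + v|^2 <= |y|^2] expands to
     [|u - v|^2 <= 2 (y.u - y.v)], and the left side is positive. *)
  have := j_max j' inj_j'; rewrite /sum_sqnorm psum_j' sqnorm_sub_add -/y.
  have := sqnorm_omega_sub_gt0 M_gt1 ne; lra.
have cJ : #|J| = d.+1 by rewrite card_imset // card_ord.
have [|p q r s /andP[lt_pq lt_qr] lt_rs pJ qJ rJ|p q r s /andP[lt_pq lt_qr] lt_rs pJ qJ rJ|r rP] :=
    @cyclic_interval M d.+1 J _ cJ.
- by lia.
- apply: contraT => sJ; exfalso.
  by apply: (@no_alternation M M_gt1 y p q r s); rewrite ?lt_pq ?lt_rs ?ltn_ord ?sep.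
- apply/negP => sJ.
  by apply: (@no_alternation M M_gt1 (- y) p q r s);
    rewrite ?lt_pq ?lt_rs ?ltn_ord ?dot_complexN ?ltrN2 ?sep.
have lt_d a : ((j a + M - r) %% M < d.+1)%N by apply: rP; rewrite imset_f.
pose f a := Ordinal (lt_d a).
have inj_f : injective f.
  move=> a b /(congr1 val) /= E; apply: inj_j; apply: val_inj => /=.
  have lt_r := ltn_ord r; have lt_a := ltn_ord (j a); have lt_b := ltn_ord (j b).
  move/eqP: E; rewrite -(eqn_modDr r) !subnK; try lia.
  by rewrite !modnDr !modn_small // => /eqP.
exists r, (perm inj_f); apply/ffunP => a; apply: val_inj; rewrite ffunE /= permE /=.
rewrite modnDmr subnKC; last by have := ltn_ord r; lia.
by rewrite modnDr modn_small.
Qed.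

(** The finite set of injective configurations has a maximiser; it is an arc by [exchange_arc], and
    all arcs share the same value. *)
Lemma sum_sqnorm_le (j : conf) : injective j ->
  sum_sqnorm j <= (sin (half_angle M d.+1) / sin (half_angle M 1)) ^+ 2.
Proof.
move=> inj_j; have inj_jb : injectiveb j by apply/injectiveP.
have [j0 inj_j0 j0_max] := @arg_maxP _ R conf j (fun j : conf => injectiveb j) sum_sqnorm inj_jb.
have [r [s j0E]] : exists r s, j0 = circ_arc r s.
  apply: exchange_arc; first exact/injectiveP.
  by move=> j' /injectiveP; apply: j0_max.
by rewrite -(sum_sqnorm_arc r s) -j0E; apply: j0_max.
Qed.

Lemma sum_sqnorm_max (j : conf) : injective j ->
  sum_sqnorm j = (sin (half_angle M d.+1) / sin (half_angle M 1)) ^+ 2 ->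
    exists r s, j = circ_arc r s.
Proof.
by move=> inj_j eq_j; apply: exchange_arc => // j' inj_j'; rewrite eq_j; apply: sum_sqnorm_le.
Qed.

End Arcs.

(** Exactly [n - t] pairs [i < j] below [n] have difference [t]; this collects the Vandermonde
    factors into the powers found in [C_dL]. *)
Lemma prod_differences (K : comPzRingType) (f : nat -> K) (n : nat) :
  (\prod_(i < n) \prod_(j < n | (i < j)%N) f (j - i)%N = \prod_(1 <= t < n) f t ^+ (n - t))%R.
Proof.
elim: n => [|n IH]; first by rewrite big_ord0 big_geq.
rewrite big_ord_recr /= [X in (_ * X)%R]big_pred0; last first.
  by move=> j; have := ltn_ord j; lia.
rewrite mulr1 (eq_bigr (fun i : 'I_n =>
    (\prod_(j < n | (i < j)%N) f (j - i)%N) * f (n - i)%N)%R); last first.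
  by move=> i _; rewrite big_mkcond big_ord_recr /= ltn_ord -big_mkcond.
rewrite big_split /= IH.
have -> : (\prod_(i < n) f (n - i)%N = \prod_(1 <= t < n.+1) f t)%R.
  rewrite -(big_mkord xpredT (fun i => f (n - i)%N)) big_nat_rev add0n big_add1 /=.
  by apply: eq_big_nat => i /andP[_ lt_i]; congr f; lia.
case: n {IH} => [|n]; first by rewrite !big_geq ?mulr1.
have -> : (\prod_(1 <= t < n.+1) f t ^+ (n.+1 - t) = \prod_(1 <= t < n.+2) f t ^+ (n.+1 - t))%R.
  by rewrite [RHS]big_nat_recr //= subnn expr0 mulr1.
rewrite -big_split /=; apply: eq_big_nat => t /andP[_ lt_t].
by rewrite -exprSr -subSn.
Qed.

(** * Weights of the configurations and the exact formula *)

Section Weights.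
Local Open Scope ring_scope.
Variables d L : nat.
Hypothesis L_gt0 : (0 < L)%N.
Notation M := (d.+1 + L)%N.
Notation w := (omega M).
Notation conf := {ffun 'I_d.+1 -> 'I_M}.

Let M_gt1 : (1 < M)%N. Proof. by lia. Qed.
Let w_prim := prim_omega M_gt1.

Definition weight (j : conf) : R := sqnorm (slater w j (empty_shape d.+1)).

Lemma sqnorm_root_char (a : nat) (t : int) : sqnorm (root_char w a t) = 1.
Proof.
apply: complexI; rewrite -mul_conj_sqnorm (root_char_conj w_prim) -(root_charD w_prim) subrr.
by rewrite root_char0.
Qed.

Lemma root_char_mod (a b : nat) (t : int) :
  root_char w ((a + b) %% M) t = root_char w a t * root_char w b t.
Proof.
rewrite /root_char -expfzDr ?(w_neq0 w_prim) // -mulrDl -PoszD.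
rewrite [in RHS](divn_eq (a + b) M) PoszD PoszM mulrDl expfzDr ?(w_neq0 w_prim) //.
by rewrite (mulrC _ (Posz M)) -[in RHS](mulrA (Posz M)) (wM w_prim) mul1r.
Qed.

(** The exponents of the empty shape are [0, -1, -2, ...], so up to a row permutation and factors of
    modulus one coming from [r], the determinant is a Vandermonde in powers of [w^-1]. *)
Lemma weight_arc (r : 'I_M) (s : {perm 'I_d.+1}) :
  weight (circ_arc r s) = \prod_(1 <= t < d.+1) (4 * sin (half_angle M t) ^+ 2) ^+ (d.+1 - t).
Proof.
pose V := Vandermonde d.+1 (\row_(b < d.+1) (w^-1 ^+ b)).
have matE : \matrix_(a, b) root_char w (circ_arc r s a) (empty_shape d.+1 b) =
    row_perm s V *m diag_mx (\row_b root_char w r (empty_shape d.+1 b)).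
  apply/matrixP => a b; rewrite mul_mx_diag !mxE !ffunE root_char_mod mulrC; congr (_ * _).
  by rewrite /root_char mulrN -exprz_inv -PoszM -exprnP mulnC exprM.
rewrite /weight /slater matE row_permE !det_mulmx det_perm det_diag det_Vandermonde.
rewrite !sqnormM sqnormX sqnormN sqnorm1 expr1n mul1r !sqnorm_prod.
rewrite [X in _ * X]big1 ?mulr1; last by move=> b _; rewrite mxE sqnorm_root_char.
rewrite -prod_differences; apply: eq_bigr => i _; rewrite sqnorm_prod; apply: eq_bigr => j lt_ij.
rewrite !mxE -(conj_w w_prim) -!rmorphXn -rmorphB sqnorm_conj -sqnorm_omegaX_sub1.
rewrite -{1}(subnK (ltnW lt_ij)) exprD -{2}[w ^+ i]mul1r -mulrBl sqnormM sqnormX sqnorm_omega.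
by rewrite expr1n mulr1.
Qed.

Lemma weight_eq0 (j : conf) : ~~ injectiveb j -> weight j = 0.
Proof. by move=> /(slater_eq0 w) nj; rewrite /weight nj /sqnorm /= expr0n addr0. Qed.

(** This is the moment of the empty shape with [k = 0], in which every factor meets its
    conjugate. *)
Lemma card_S_dL_sum (n : nat) :
  #|S_dL d.+1 L n|%:R * ((d.+1)`! * M ^ d.+1)%:R =
    \sum_(j : conf) sum_sqnorm j ^+ n * weight j :> R.
Proof.
apply: complexI; rewrite -natrM rmorph_nat card_S_dL_shape.
rewrite -(shape_count_moment L_gt0 w_prim); first last.
- by rewrite shape_size_empty_shape.
- by rewrite ffunE.
- exact: valid_empty_shape.
rewrite /moment rmorph_sum /=; apply: eq_bigr => j _.
rewrite expr0 mul1r rmorphM rmorphXn /= /weight /sum_sqnorm -!mul_conj_sqnorm; congr (_ ^+ _ * _).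
congr (_ * _); rewrite /psum rmorph_sum; apply: eq_bigr => a _.
by rewrite /= (root_char_conj w_prim).
Qed.

End Weights.

(** * The limit *)

Section Limit.
Local Open Scope ring_scope.

Lemma Un_cv_geometric (c q : R) : 0 <= q < 1 -> Un_cv (fun n => c * q ^+ n) 0.
Proof.
move=> /andP[q_ge0 /RltP q_lt1].
have cv_q : Un_cv (fun n => q ^+ n) 0.
  move=> e e_gt0; have abs_q : Rlt (Rabs q) R1.
    by rewrite Rabs_pos_eq //; apply/RleP.
  have [n0 n0P] := pow_lt_1_zero q abs_q e e_gt0.
  by exists n0 => n /n0P; rewrite /Rdist Rminus_0_r RpowE.
have cv_c : Un_cv (fun _ => c) c.
  by move=> e e_gt0; exists 0%N => n _; rewrite /Rdist Rminus_diag Rabs_R0.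
have := CV_mult _ _ _ _ cv_c cv_q.
by rewrite RmultE mulr0.
Qed.

Lemma Un_cv_sum0 (I : Type) (s : seq I) (P : pred I) (F : I -> nat -> R) :
  (forall i, P i -> Un_cv (F i) 0) -> Un_cv (fun n => \sum_(i <- s | P i) F i n) 0.
Proof.
move=> cvF; elim: s => [|i s IH].
  by move=> e e_gt0; exists 0%N => n _; rewrite big_nil /Rdist Rminus_diag Rabs_R0.
case Pi: (P i); last first.
  by move=> e e_gt0; have [n0 H] := IH e e_gt0; exists n0 => n /H; rewrite big_cons Pi.
have := CV_plus _ _ _ _ (cvF i Pi) IH; rewrite RplusE addr0 => cv e e_gt0.
by have [n0 H] := cv e e_gt0; exists n0 => n /H; rewrite big_cons Pi.
Qed.

Lemma growthE (d L : nat) :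
  growth d L = sin (half_angle (d + L) d) / sin (half_angle (d + L) 1).
Proof. by rewrite /growth /half_angle mulr1 !RdivE RmultE !INRE. Qed.

Lemma C_dLE (d L : nat) : C_dL d.+1 L =
  (\prod_(1 <= t < d.+1) (4 * sin (half_angle (d.+1 + L) t) ^+ 2) ^+ (d.+1 - t)) /
    (d.+1 + L)%:R ^+ d.
Proof.
rewrite /C_dL RmultE RinvE RpowE INRE subn1 mulrC; congr (_ / _).
rewrite foldrE big_map /index_iota subn1; apply: eq_bigr => t _.
rewrite !RpowE !RmultE RdivE !INRE /half_angle; congr ((_ * _) ^+ _).
by rewrite -INRE INR_IZR_INZ.
Qed.

End Limit.

Theorem theorem10p4 (d L : nat) (hd : 0 < d) (hL : 0 < L) :
  Un_cv (fun n => Rdiv (INR #|S_dL d L n|) (Rmult (C_dL d L) (pow (growth d L) (2 * n)))) R1.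
Proof.
case: d hd => // d _.
pose M := d.+1 + L; pose rho : R := ((sin (half_angle M d.+1) / sin (half_angle M 1)) ^+ 2)%R.
pose W : R := (\prod_(1 <= t < d.+1) (4 * sin (half_angle M t) ^+ 2) ^+ (d.+1 - t))%R.
(* [C_dL] times the normalisation of [card_S_dL_sum]. It equals [(d+1)! M W], the number of arcs
   times their common weight, so the arcs contribute exactly [1] to the ratio. *)
pose K : R := (((d.+1)`! * M ^ d.+1)%:R * (W / M%:R ^+ d))%R.
have M_gt1 : 1 < M by rewrite /M; lia.
have sin_gt0 t : 0 < t < d.+2 -> (0 < sin (half_angle M t))%R.
  by move=> lt_t; apply: sin_half_angle_gt0; rewrite /M; lia.
have rho_gt0 : (0 < rho)%R by apply: exprn_gt0; apply: divr_gt0; apply: sin_gt0; lia.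
have W_gt0 : (0 < W)%R.
  rewrite /W big_nat_cond; apply: prodr_gt0 => t; rewrite andbT => /andP[t_gt0 lt_t].
  apply: exprn_gt0; apply: mulr_gt0; first by rewrite ltr0n.
  by apply: exprn_gt0; apply: sin_gt0; lia.
have M_neq0 : (M%:R != 0 :> R)%R by rewrite pnatr_eq0; lia.
have K_gt0 : (0 < K)%R.
  apply: mulr_gt0; first by rewrite ltr0n muln_gt0 fact_gt0 expn_gt0 ltnW.
  by apply: divr_gt0 => //; apply: exprn_gt0; rewrite ltr0n ltnW.
pose arcs := [set circ_arc p.1 p.2 | p : 'I_M * {perm 'I_d.+1}].
have card_arcs : #|arcs| = (d.+1)`! * M.
  rewrite card_imset ?card_prod ?card_ord ?card_Sn 1?mulnC //.
  by move=> [r s] [r' s'] /= /(circ_arc_inj hL) [-> ->].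
pose G (j : {ffun 'I_d.+1 -> 'I_M}) (n : nat) : R := (weight j / K * (sum_sqnorm j / rho) ^+ n)%R.
have ratioE n : Rdiv (INR #|S_dL d.+1 L n|) (Rmult (C_dL d.+1 L) (pow (growth d.+1 L) (2 * n))) =
    (1 + \sum_(j | j \notin arcs) G j n)%R.
  have -> : (1 = \sum_(j in arcs) G j n :> R)%R.
    rewrite (eq_bigr (fun _ => W / K)%R).
      rewrite sumr_const card_arcs -mulr_natl /K natrM natrM natrX exprS.
      by field; rewrite ?M_neq0 ?gt_eqF ?exprn_gt0 ?ltr0n ?fact_gt0 //; lia.
    move=> _ /imsetP[[r s] _ ->]; rewrite /G (weight_arc hL) (sum_sqnorm_arc hL) divff ?expr1n
      ?mulr1 //.
    by rewrite gt_eqF.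
  transitivity (\sum_j G j n)%R; last by rewrite (bigID (mem arcs)).
  rewrite RdivE RmultE RpowE INRE growthE C_dLE -/M -/W exprM -/rho.
  have ratio_gen (a b k r : R) : (a / k * (b / r) = b * a / (k * r))%R.
    by rewrite invfM mulrACA [(a * b)%R]mulrC.
  have sumE : (\sum_j G j n = (\sum_(j : {ffun 'I_d.+1 ->
    'I_M}) sum_sqnorm j ^+ n * weight j) / (K * rho ^+ n))%R.
    rewrite mulr_suml; apply: eq_bigr => j _; rewrite /G expr_div_n.
    exact: ratio_gen.
  rewrite sumE.
  rewrite -(card_S_dL_sum d hL) -/M /K.
  have N_neq0 : (((d.+1)`! * M ^ d.+1)%:R != 0 :> R)%R.
    by rewrite pnatr_eq0 -lt0n muln_gt0 fact_gt0 expn_gt0 ltnW.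
  have cancel (c a b r : R) : (a != 0 -> c / (b * r) = c * a / (a * b * r))%R.
    by move=> a_neq0; rewrite -[(a * b * r)%R]mulrA [(c * a)%R]mulrC -mulf_div divff ?mul1r.
  exact: cancel.
have cv0 : Un_cv (fun n => \sum_(j | j \notin arcs) G j n)%R 0%R.
  apply: Un_cv_sum0 => j j_arcs; case: (boolP (injectiveb j)) => [/injectiveP inj_j|ninj].
    apply: Un_cv_geometric; rewrite divr_ge0 ?sqnorm_ge0 ?ltW //=.
    rewrite ltr_pdivrMr // mul1r lt_neqAle (sum_sqnorm_le hL) // andbT.
    apply: contra j_arcs => /eqP /(sum_sqnorm_max hL inj_j) [r [s ->]].
    by apply/imsetP; exists (r, s).
  (* With a repeated root the sum may exceed the maximum over injective configurations, so no
     geometric decay is available; but the weight vanishes and the term is the zero sequence. *)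
  rewrite (_ : G j = fun n => 0 * 0 ^+ n)%R; first by apply: Un_cv_geometric; rewrite lexx ltr01.
  by apply: funext => n; rewrite /G weight_eq0 // !mul0r.
move=> e e_gt0; have [n0 n0P] := cv0 e e_gt0; exists n0 => n le_n.
rewrite ratioE; have := n0P n le_n.
by rewrite /Rdist !RminusE subr0 addrAC subrr add0r.
Qed.
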